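(* Let $(\Omega,\mathcal F,\mu,\{\mathcal F_n\}_{n\ge 0})$ be a filtered probability space, let $1<p<\infty$, and let $w$ be a weight with $\sigma=w^{-\frac1{p-1}}\in L^1$. There is a constant $C$ such that $$\|Mf\|_{L^p(w)}\le C\,\|f\|_{L^p(w)}\qquad\text{for all } f\in L^p(w)\qquad( * )$$ if and only if $w\in A_p$. Moreover, if $\|M\|$ denotes the smallest constant $C$ in $( * )$, then $$[w]_{A_p}\le\|M\|^p\qquad\text{and}\qquad \|M\|\le C_p\,[w]_{A_p}^{\frac1{p-1}},$$ where $C_p$ depends only on $p$ (not on $w$).
   Context: Filtered probability space: $(\Omega,\mathcal F,\mu)$ is a complete probability space, $\{\mathcal F_n\}_{n\ge0}$ is an increasing sequence of sub-$\sigma$-algebras of $\mathcal F$, each $(\Omega,\mathcal F_n,\mu)$ is complete, and $\mathcal F$ is the $\sigma$-algebra generated by $\bigcup_n\mathcal F_n$. Doob's maximal operator: $Mf=\sup_{n\ge0}|f_n|$, where $g_n=\mathbb E(g\mid\mathcal F_n)$ for $g\in L^1(\mu)$. Weights: a weight $w$ is a positive random variable in $L^1(\mu)$; $\|f\|_{L^p(w)}=(\int_\Omega|f|^pw\,d\mu)^{1/p}$. (Since $\sigma\in L^1$, $L^p(w)\subset L^1(\mu)$.) $[w]_{A_p}=\sup_{n\ge0}\|w_n\,(\sigma_n)^{p-1}\|_\infty$, and $w\in A_p$ means $[w]_{A_p}<\infty$. *)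

(* Defs.v *)
From HB Require Import structures.
From mathcomp Require Export all_boot all_order all_algebra.
From mathcomp Require Export all_classical all_reals all_analysis.
Export Order.TTheory GRing.Theory Num.Theory.
Export numFieldNormedType.Exports.

Set Implicit Arguments.
Unset Strict Implicit.
Unset Printing Implicit Defensive.

Local Open Scope classical_set_scope.
Local Open Scope ring_scope.

(* The ambient sigma-algebra is the one carried by [T]; the sub-sigma-algebras
   are families of subsets of [T].  [fs_complete] is completeness of the
   restriction of [P] to [F n]. *)
Record filtered_space (R : realType) (d : measure_display)
    (T : measurableType d) (P : probability T R) (F : nat -> set (set T)) :
    Prop := FilteredSpace {
  fs_ambient_complete : measure_is_complete P ;
  fs_sigma : forall n, sigma_algebra setT (F n) ;
  fs_sub : forall n, F n `<=` measurable ;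
  fs_incr : forall m n, (m <= n)%N -> F m `<=` F n ;
  fs_complete : forall n (A N : set T),
    F n N -> P N = 0%E -> A `<=` N -> F n A ;
  fs_generated : <<s \bigcup_n F n >> = (measurable : set (set T)) }.

Definition is_condexp (R : realType) (d : measure_display)
    (T : measurableType d) (P : probability T R) (G : set (set T))
    (f g : T -> R) : Prop :=
  [/\ forall B : set R, measurable B -> G (g @^-1` B),
      P.-integrable setT (EFin \o g) &
      forall A, G A ->
        (\int[P]_(x in A) (g x)%:E = \int[P]_(x in A) (f x)%:E)%E].

(* An arbitrary version of E(f | G); the value is the junk constant 0 when no
   version exists, which cannot happen for f in L^1 and G a sub-sigma-algebra
   of the ambient one. *)
Definition condexp (R : realType) (d : measure_display)
    (T : measurableType d) (P : probability T R) (G : set (set T))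
    (f : T -> R) : T -> R :=
  xget (fun=> 0) [set g | is_condexp P G f g].

Definition doob_max (R : realType) (d : measure_display)
    (T : measurableType d) (P : probability T R) (F : nat -> set (set T))
    (f : T -> R) (x : T) : \bar R :=
  ereal_sup [set (`|condexp P (F n) f x|)%:E | n in [set: nat]].

Definition is_weight (R : realType) (d : measure_display)
    (T : measurableType d) (P : probability T R) (w : T -> R) : Prop :=
  P.-integrable setT (EFin \o w) /\ {ae P, forall x, 0 < w x}.

Definition dual_weight (R : realType) (T : Type) (p : R) (w : T -> R) :
    T -> R :=
  fun x => w x `^ (- (p - 1)^-1).

(* Extended-real-valued arguments are needed because the maximal function may
   be infinite. *)
Definition wLnorm (R : realType) (d : measure_display)
    (T : measurableType d) (P : probability T R) (p : R) (w : T -> R)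
    (f : T -> \bar R) : \bar R :=
  ((\int[P]_x (`|f x| `^ p * (w x)%:E)) `^ p^-1)%E.

Definition in_wLp (R : realType) (d : measure_display)
    (T : measurableType d) (P : probability T R) (p : R) (w f : T -> R) :
    Prop :=
  measurable_fun setT f /\ (wLnorm P p w (EFin \o f) < +oo)%E.

Definition Ap_const (R : realType) (d : measure_display)
    (T : measurableType d) (P : probability T R) (F : nat -> set (set T))
    (p : R) (w : T -> R) : \bar R :=
  ereal_sup [set Lnorm P +oo%E (fun x =>
      (condexp P (F n) w x
       * condexp P (F n) (dual_weight p w) x `^ (p - 1))%:E)
    | n in [set: nat]].

Definition doob_bound (R : realType) (d : measure_display)
    (T : measurableType d) (P : probability T R) (F : nat -> set (set T))
    (p : R) (w : T -> R) (C : R) : Prop :=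
  forall f : T -> R, in_wLp P p w f ->
    (wLnorm P p w (doob_max P F f) <= C%:E * wLnorm P p w (EFin \o f))%E.

Definition is_doob_norm (R : realType) (d : measure_display)
    (T : measurableType d) (P : probability T R) (F : nat -> set (set T))
    (p : R) (w : T -> R) (N : R) : Prop :=
  doob_bound P F p w N /\ forall C, doob_bound P F p w C -> N <= C.

(* Main.v *)
(** Sufficiency is Lerner's argument.  Write [s] for the dual weight, [f_n],
    [w_n], [s_n] for conditional expectations on [F n], [c] for the [A_p]
    constant and [q = p / (p - 1)].  For [f >= 0] put [h_n = f_n / s_n] and let
    [G] be the maximum of [h_0, ..., h_N].  Since
    [f_n ^ (p-1) w_n = h_n ^ (p-1) s_n ^ (p-1) w_n <= c G ^ (p-1)],
    the functions [f_n ^ (p-1)] are dominated by the conditional expectations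
    of [c G ^ (p-1) / w] with respect to the measure [w dP]; Doob's inequality
    for [w dP] in [L^q], followed by Doob's inequality for [s dP] in [L^p]
    applied to [h_n], which is the conditional expectation of [f / s] for
    [s dP], bounds the [L^p(w)] norm of the maximal function.  Both Doob
    inequalities only use the integral inequalities over sets of [F n] and
    follow by summation by parts from
    [x^q - y^q <= q / (q-1) (x^(q-1) - y^(q-1)) x] for [0 <= y <= x].

    Necessity follows by testing the bound on [s] restricted to the set of
    [F n] where [K s_n < s_n ^ p w_n], which is then null. *)

From HB Require Import structures.
Require Import Defs.
From mathcomp Require Import measurable_realfun ess_sup_inf.
From mathcomp Require Import ring lra.

Set Implicit Arguments.
Unset Strict Implicit.
Unset Printing Implicit Defensive.

Local Open Scope classical_set_scope.
Local Open Scope ring_scope.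

(** * Conditional expectations *)

(** Stated on preimages, as in the first clause of [is_condexp], because [G] is only a family of
    sets; [measurable_wrtP] gives access to the closure properties of measurable functions. *)
Definition measurable_wrt (R : realType) (T : Type) (G : set (set T))
    (f : T -> R) : Prop :=
  forall B : set R, measurable B -> G (f @^-1` B).

Section sub_sigma_algebra.
Import HBNNSimple.
Context (R : realType) (d : measure_display) (T : measurableType d)
  (P : probability T R) (G : set (set T)).
Hypothesis sG : sigma_algebra setT G.
Hypothesis GT : G `<=` measurable.
Implicit Types f g u : T -> R.

Lemma measurable_wrtP f :
  measurable_wrt G f <->
  measurable_fun [set: g_sigma_algebraType G] (f : g_sigma_algebraType G -> R).
Proof.
split=> [mf _ B mB|mf B mB].
  by rewrite setTI (measurable_g_measurableTypeE sG); exact: mf.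
have := mf measurableT _ mB.
by rewrite setTI (measurable_g_measurableTypeE sG).
Qed.

Lemma measurable_subE (A : set T) :
  measurable (A : set (g_sigma_algebraType G)) = G A.
Proof. by rewrite (measurable_g_measurableTypeE sG). Qed.

Lemma measurable_wrt_measurable_fun f :
  measurable_wrt G f -> measurable_fun setT f.
Proof. by move=> mf _ B mB; rewrite setTI; exact/GT/mf. Qed.

Lemma measurable_wrt_cst (a : R) : measurable_wrt G (fun=> a).
Proof. by apply/measurable_wrtP; exact: measurable_cst. Qed.

Lemma measurable_wrt_indic (A : set T) : G A -> measurable_wrt G (\1_A : T -> R).
Proof.
by move=> GA; apply/measurable_wrtP; apply: measurable_indic;
  rewrite measurable_subE.
Qed.

Lemma measurable_wrtM f g : measurable_wrt G f -> measurable_wrt G g ->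
  measurable_wrt G (fun x => f x * g x).
Proof.
move=> /measurable_wrtP mf /measurable_wrtP mg.
by apply/measurable_wrtP; exact: measurable_funM.
Qed.

Lemma measurable_wrtB f g : measurable_wrt G f -> measurable_wrt G g ->
  measurable_wrt G (fun x => f x - g x).
Proof.
move=> /measurable_wrtP mf /measurable_wrtP mg.
by apply/measurable_wrtP; exact: measurable_funB.
Qed.

Lemma measurable_wrt_max f g : measurable_wrt G f -> measurable_wrt G g ->
  measurable_wrt G (fun x => Num.max (f x) (g x)).
Proof.
move=> /measurable_wrtP mf /measurable_wrtP mg.
by apply/measurable_wrtP; exact: measurable_maxr.
Qed.

Lemma measurable_wrt_min f g : measurable_wrt G f -> measurable_wrt G g ->
  measurable_wrt G (fun x => Num.min (f x) (g x)).
Proof.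
move=> /measurable_wrtP mf /measurable_wrtP mg.
by apply/measurable_wrtP; exact: measurable_minr.
Qed.

Lemma measurable_wrt_powR f (r : R) : measurable_wrt G f ->
  measurable_wrt G (fun x => f x `^ r).
Proof.
move=> mf B mB; apply: (mf ((fun y => y `^ r) @^-1` B)).
by rewrite -[_ @^-1` _]setTI; exact: measurable_powR.
Qed.

Lemma measurable_id_sub :
  measurable_fun [set: T] (id : T -> g_sigma_algebraType G).
Proof.
move=> _ A; rewrite (measurable_g_measurableTypeE sG) => GA.
by rewrite setTI; exact: GT.
Qed.

Lemma integral_mul_indic (A B : set T) f :
  (\int[P]_(x in B) (f x * \1_A x)%:E = \int[P]_(x in B `&` A) (f x)%:E)%E.
Proof.
rewrite integral_mkcondr; apply: eq_integral => x _.
by rewrite patchE indicE; case: ifP; rewrite ?mulr1 ?mulr0.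
Qed.

(** On [A] the positive function [g - f] has integral at most 0, so it vanishes almost everywhere
    there, which leaves only a null set. *)
Lemma null_of_integral_le (A : set T) f g : measurable A ->
  P.-integrable A (EFin \o f) -> P.-integrable A (EFin \o g) ->
  (forall x, A x -> f x < g x) ->
  (\int[P]_(x in A) (g x)%:E <= \int[P]_(x in A) (f x)%:E)%E ->
  P A = 0%E.
Proof.
move=> mA intf intg fg gf.
have : (\int[P]_(x in A) (`|(g x - f x)%:E|))%E = 0%E.
  apply/eqP; rewrite eq_le integral_ge0 ?andbT//.
  rewrite (eq_integral (fun x => (g x)%:E - (f x)%:E)%E); last first.
    move=> x /set_mem Ax; rewrite /= ger0_norm ?EFinB//.
    by rewrite subr_ge0; exact/ltW/fg.
  rewrite integralB_EFin// sube_le0//.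
move/ae_eq_integral_abs => /(_ mA) H.
have [|N [mN N0 sN]] := H.
  apply/measurable_EFinP/measurable_funB; apply/measurable_EFinP; by
    [exact: measurable_int intg | exact: measurable_int intf].
apply: (subset_measure0 mA mN _ N0) => x Ax; apply: sN => /= /(_ Ax) /eqP.
by rewrite eqe subr_eq0 => /eqP gfx; have := fg _ Ax; rewrite gfx ltxx.
Qed.

(* Both integrals are approximated through the same simple functions, which are
   built in the sub-sigma-algebra [G]. *)
Lemma le_integral_mul (u f g : T -> R) : measurable_wrt G u ->
  (forall x, 0 <= u x) ->
  measurable_fun setT f -> (forall x, 0 <= f x) ->
  measurable_fun setT g -> (forall x, 0 <= g x) ->
  (forall A, G A ->
    (\int[P]_(x in A) (f x)%:E <= \int[P]_(x in A) (g x)%:E)%E) ->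
  (\int[P]_x (u x * f x)%:E <= \int[P]_x (u x * g x)%:E)%E.
Proof.
move=> /measurable_wrtP mu u0 mf f0 mg g0 fg.
have mTG : measurable [set: g_sigma_algebraType G] by [].
have muE : measurable_fun [set: g_sigma_algebraType G] (EFin \o u).
  exact/measurable_EFinP.
pose u_ := nnsfun_approx mTG muE.
have GA n k : G (u_ n @^-1` [set k]).
  by rewrite -measurable_subE; exact: measurable_sfunP.
have mun n : measurable_fun [set: T] (u_ n : T -> R).
  apply: measurable_wrt_measurable_fun.
  by apply/measurable_wrtP.
have step (h : T -> R) : measurable_fun setT h -> (forall x, 0 <= h x) ->
    (\int[P]_x (u x * h x)%:E =
     limn (fun n => \int[P]_x (u_ n x * h x)%:E))%E.
  move=> mh h0; rewrite -monotone_convergence//.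
  - apply: eq_integral => x _; apply/esym/cvg_lim => //.
    under eq_fun do rewrite EFinM.
    rewrite EFinM; apply: cvgeZr => //.
    apply: (cvg_nnsfun_approx mTG muE) => //.
    by move=> y _ /=; rewrite lee_fin.
  - by move=> n; apply/measurable_EFinP; apply: measurable_funM.
  - by move=> n x _; rewrite lee_fin mulr_ge0.
  - move=> x _ m n mn; rewrite lee_fin ler_wpM2r//.
    by have /lefP := nd_nnsfun_approx mTG muE mn; apply.
(* The level sets of [u_ n] lie in [G], so this expansion is a nonnegative combination of integrals
   over sets to which [fg] applies. *)
have simple (h : T -> R) n : measurable_fun setT h -> (forall x, 0 <= h x) ->
    (\int[P]_x (u_ n x * h x)%:E =
     \sum_(k \in range (u_ n)) (k%:E * \int[P]_(x in u_ n @^-1` [set k]) (h x)%:E))%E.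
  move=> mh h0.
  transitivity (\int[P]_x (\sum_(k \in range (u_ n))
      (k * \1_(u_ n @^-1` [set k]) x * h x)%:E))%E.
    apply: eq_integral => x _; rewrite fimfunE fsumEFin//; congr EFin.
    rewrite -mulr_fsuml//.
  rewrite ge0_integral_fsum//; last 2 first.
  - move=> k; apply/measurable_EFinP; apply: measurable_funM => //.
    apply: measurable_funM => //; apply: measurable_indic; exact/GT/GA.
  - by move=> k x _;
      rewrite EFinM mule_ge0 ?lee_fin// -lee_fin EFinM nnfun_muleindic_ge0.
  apply: eq_fsbigr => k /set_mem [t _ <-].
  rewrite [in RHS]integral_mkcond -ge0_integralZl//; last 3 first.
  - apply/(measurable_restrictT _ _).1; first exact/GT/GA.
    exact/measurable_EFinP/measurable_funTS.
  - by move=> x _; rewrite patchE; case: ifP; rewrite // lee_fin.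
  - by rewrite lee_fin.
  apply: eq_integral => x _; rewrite patchE indicE.
  by case: ifPn => _ ; rewrite ?mulr1 ?mulr0 ?mul0r ?mule0// EFinM.
have cvg (h : T -> R) : measurable_fun setT h -> (forall x, 0 <= h x) ->
    cvgn (fun n => \int[P]_x (u_ n x * h x)%:E)%E.
  move=> mh h0; apply: ereal_nondecreasing_is_cvgn => m n mn.
  apply: ge0_le_integral => //.
  - by move=> x _; rewrite lee_fin mulr_ge0.
  - by apply/measurable_EFinP; apply: measurable_funM.
  - by apply/measurable_EFinP; apply: measurable_funM.
  - move=> x _; rewrite lee_fin ler_wpM2r//.
    by have /lefP := nd_nnsfun_approx mTG muE mn; apply.
rewrite !step//; apply: lee_lim; [exact: cvg..|].
apply: nearW => n; rewrite !simple//.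
apply: lee_fsum => // k [t _ <-].
by rewrite lee_wpmul2l ?lee_fin//; exact/fg/GA.
Qed.

(** * Existence, order and pull-out properties of conditional expectations *)

Lemma ae_eq_is_condexp f g g' : is_condexp P G f g -> measurable_wrt G g' ->
  {ae P, forall x, g x = g' x} -> is_condexp P G f g'.
Proof.
move=> [mg intg gE] mg' gg'.
have mg0 := measurable_wrt_measurable_fun mg.
have mg'0 := measurable_wrt_measurable_fun mg'.
have ggE (A : set T) : measurable A -> ae_eq P A (EFin \o g) (EFin \o g').
  by move=> mA; apply: filterS gg' => x /= -> _.
split=> //.
  apply/integrableP; split; first exact/measurable_EFinP.
  have /integrableP[_] := intg;
    rewrite (ae_eq_integral (fun x => `|(g' x)%:E|)%E)//.
  - by apply: measurableT_comp => //; exact/measurable_EFinP.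
  - by apply: measurableT_comp => //; exact/measurable_EFinP.
  - by apply: filterS gg' => x /= -> _.
move=> A GA; rewrite -gE//; apply: ae_eq_integral => //.
- exact: GT.
- exact/measurable_EFinP/measurable_funTS.
- exact/measurable_EFinP/measurable_funTS.
- by apply: ae_eq_sym; apply: ggE; exact: GT.
Qed.

(** Pushing a measure forward along the identity, seen as a map into [T] with the smaller
    sigma-algebra, restricts the measure to [G]. *)
Let idG := isMeasurableFun.Build _ _ _ _ _ measurable_id_sub.
Let idGp : {mfun T >-> g_sigma_algebraType G} :=
  HB.pack (id : T -> g_sigma_algebraType G) idG.

(** Radon-Nikodym: the charge sending [A] to the integral of [f] over [A], restricted to [G], is
    absolutely continuous with respect to the restriction of [P], and its density is the required
    version. *)
Lemma is_condexp_ex f : P.-integrable setT (EFin \o f) ->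
  exists g, is_condexp P G f g.
Proof.
move=> intf.
pose push : {charge set (g_sigma_algebraType G) -> \bar R} :=
  pushforward (induced_charge intf) idGp.
pose nu := push measurable_id_sub.
pose mu : probability (g_sigma_algebraType G) R := distribution P idGp.
have numu : nu `<< mu.
  apply/null_content_dominatesP => A mA.
  rewrite measurable_subE in mA.
  move=> muA; apply: null_set_integral => //.
  - exact: GT.
  - by apply: measurable_funTS; exact: measurable_int intf.
pose g := fine \o Radon_Nikodym nu mu.
have gE x : (g x)%:E = Radon_Nikodym nu mu x.
  by rewrite /g/= fineK//; exact: Radon_Nikodym_fin_num.
have := Radon_Nikodym_integrable numu.
rewrite (_ : Radon_Nikodym nu mu = EFin \o g); last first.
  by apply/funext => x; rewrite /= gE.
move=> intg.
have mg : measurable_wrt G g.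
  apply/measurable_wrtP; apply/measurable_EFinP; exact: measurable_int intg.
have intgT : P.-integrable [set: T] (EFin \o g).
  apply/integrableP; split.
    by apply/measurable_EFinP; exact: measurable_wrt_measurable_fun.
  have /integrableP[mgG] := intg.
  rewrite ge0_integral_distribution//; exact: measurableT_comp.
exists g; split=> // A GA.
have mA : measurable (A : set (g_sigma_algebraType G)).
  by rewrite measurable_subE.
have := Radon_Nikodym_integral numu mA.
rewrite /nu /= /pushforward /induced_charge /= => ->.
rewrite (eq_integral (EFin \o g))//; last by move=> x _; rewrite -gE.
rewrite integral_pushforward//; last 2 first.
- exact: measurable_int intg.
- exact: (integrableS measurableT (GT GA) (@subsetT _ A) intgT).
Qed.

Lemma is_condexp_condexp f : P.-integrable setT (EFin \o f) ->
  is_condexp P G f (condexp P G f).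
Proof. by move=> /is_condexp_ex [g fg]; exact: (xgetI _ fg). Qed.

Lemma measurable_wrt_condexp f : measurable_wrt G (condexp P G f).
Proof.
by rewrite /condexp; case: xgetP => [g _ []//|_]; exact: measurable_wrt_cst.
Qed.

Lemma measurable_wrt_lt f g : measurable_wrt G f -> measurable_wrt G g ->
  G [set x | f x < g x].
Proof.
move=> mf mg; have /(_ `]0, +oo[%classic) := measurable_wrtB mg mf.
rewrite (_ : _ @^-1` _ = [set x | f x < g x]); first exact.
by apply/seteqP; split=> x /=; rewrite in_itv/= andbT subr_gt0.
Qed.

(** The set where [g2 < g1] belongs to [G], so over it [g1] and [g2] integrate like [f1] and [f2],
    whose order forces the set to be null. *)
Lemma is_condexp_ae_le f1 f2 g1 g2 : is_condexp P G f1 g1 ->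
  P.-integrable setT (EFin \o f1) -> P.-integrable setT (EFin \o f2) ->
  is_condexp P G f2 g2 -> (forall x, f1 x <= f2 x) ->
  {ae P, forall x, g1 x <= g2 x}.
Proof.
move=> [mg1 ig1 g1E] if1 if2 [mg2 ig2 g2E] f12.
have GA := measurable_wrt_lt mg2 mg1.
have mA := GT GA.
have intA h : P.-integrable setT (EFin \o h) ->
    P.-integrable [set x | g2 x < g1 x] (EFin \o h).
  by move=> ih; exact: integrableS ih.
exists [set x | g2 x < g1 x]; split => //; last first.
  by move=> x /=; rewrite leNgt => /negP; rewrite negbK.
apply: (@null_of_integral_le _ g2 g1) => //; [exact: intA..|].
rewrite g1E// g2E//; apply: le_integral => //; [exact: intA..|].
by move=> x _; rewrite lee_fin.
Qed.

Lemma is_condexp_ae_eq f g g' : P.-integrable setT (EFin \o f) ->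
  is_condexp P G f g -> is_condexp P G f g' -> {ae P, forall x, g x = g' x}.
Proof.
move=> intf fg fg'.
have h1 := is_condexp_ae_le fg intf intf fg' (fun=> lexx _).
have h2 := is_condexp_ae_le fg' intf intf fg (fun=> lexx _).
by move: h1 h2; apply: filterS2 => x g1 g2; apply/eqP; rewrite eq_le g1 g2.
Qed.

Lemma is_condexpN f g : P.-integrable setT (EFin \o f) ->
  is_condexp P G f g -> is_condexp P G (fun x => - f x) (fun x => - g x).
Proof.
move=> intf [mg intg gE]; split.
- apply/measurable_wrtP; apply: measurableT_comp => //; exact/measurable_wrtP.
- rewrite (_ : _ \o _ = \- (EFin \o g))%E; first exact: integrableN.
  by apply/funext => x /=; rewrite EFinN.
- move=> A GA; have mA := GT GA.
  transitivity (- \int[P]_(x in A) (g x)%:E)%E.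
    by rewrite -integralN//; apply: integrable_add_def => //;
      exact: integrableS intg.
  rewrite gE// -integralN//; apply: integrable_add_def => //;
    exact: integrableS intf.
Qed.

Lemma is_condexp_indic (A : set T) f g : G A -> is_condexp P G f g ->
  is_condexp P G (fun x => f x * \1_A x) (fun x => g x * \1_A x).
Proof.
move=> GA [mg intg gE].
have mA := GT GA.
split.
- by apply: measurable_wrtM => //; exact: measurable_wrt_indic.
- apply: (le_integrable measurableT _ _ intg).
    apply/measurable_EFinP; apply: measurable_funM;
      last exact: measurable_indic.
    exact: measurable_wrt_measurable_fun.
  move=> x _; rewrite /= lee_fin normrM ler_piMr// indicE.
  by case: (_ \in _); rewrite ?normr1 ?normr0.
- move=> B GB; have mB := GT GB.
  have GBA : G (B `&` A).
    rewrite -measurable_subE; apply: measurableI; by rewrite measurable_subE.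
  by rewrite !integral_mul_indic gE.
Qed.

(** The positive part alters a version only on a null set; the integral lemmas below ask for signs
    at every point. *)
Lemma is_condexp_ge0_version f : P.-integrable setT (EFin \o f) ->
  (forall x, 0 <= f x) ->
  exists g, is_condexp P G f g /\ forall x, 0 <= g x.
Proof.
move=> intf f0; have [g fg] := is_condexp_ex intf.
exists (fun x => Num.max (g x) 0); split; last first.
  by move=> x; rewrite le_max lexx orbT.
have [mg intg gE] := fg.
have m0 : measurable_wrt G (fun=> 0 : R) by exact: measurable_wrt_cst.
have zero : is_condexp P G (fun=> 0) (fun=> 0).
  by split=> //; exact: integrable0.
apply: (ae_eq_is_condexp fg).
  exact: measurable_wrt_max.
have := is_condexp_ae_le zero (integrable0 _ _) intf fg f0.
by apply: filterS => x gx; rewrite max_l.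
Qed.

(** Over the set of [G] where a nonnegative version vanishes, the positive [f] has integral 0. This
    set is therefore null and the value 1 may be put there, which makes division by the version
    possible. *)
Lemma is_condexp_gt0_version f : P.-integrable setT (EFin \o f) ->
  (forall x, 0 < f x) ->
  exists g, is_condexp P G f g /\ forall x, 0 < g x.
Proof.
move=> intf f0;
  have [g [fg g0]] := is_condexp_ge0_version intf (fun x => ltW (f0 x)).
exists (fun x => if 0 < g x then g x else 1); split; last first.
  by move=> x; case: ifPn.
have [mg intg gE] := fg.
apply: (ae_eq_is_condexp fg).
  apply/measurable_wrtP; apply: measurable_fun_ifT => //;
    last exact/measurable_wrtP.
  apply: measurable_fun_ltr => //; exact/measurable_wrtP.
have GA : G (~` [set x | 0 < g x]).
  rewrite -measurable_subE; apply: measurableC; rewrite measurable_subE.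
  by apply: measurable_wrt_lt => //; exact: measurable_wrt_cst.
exists (~` [set x | 0 < g x]); split; [exact: GT| |]; last first.
  by move=> x; apply: contra_not => /= ->.
have mA := GT GA.
apply: (@null_of_integral_le _ g f) => //.
- exact: integrableS intg.
- exact: integrableS intf.
- by move=> x /= /negP; rewrite -leNgt => gx; exact: le_lt_trans gx _.
- by rewrite gE.
Qed.

(** The pull-out property, by [le_integral_mul] in both directions. Nonnegativity makes it valid for
    infinite integrals too. *)
Lemma integral_condexp_mul (u f g : T -> R) : is_condexp P G f g ->
  measurable_wrt G u -> (forall x, 0 <= u x) ->
  measurable_fun setT f -> (forall x, 0 <= f x) -> (forall x, 0 <= g x) ->
  (\int[P]_x (u x * f x)%:E = \int[P]_x (u x * g x)%:E)%E.
Proof.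
move=> [mg intg gE] mu u0 mf f0 g0.
have mg' := measurable_wrt_measurable_fun mg.
by apply/eqP; rewrite eq_le; apply/andP; split;
  apply: le_integral_mul => // A GA;
  rewrite gE.
Qed.

Lemma integral_condexp_mul_in (A : set T) (u f g : T -> R) :
  is_condexp P G f g -> G A ->
  measurable_wrt G u -> (forall x, 0 <= u x) ->
  measurable_fun setT f -> (forall x, 0 <= f x) -> (forall x, 0 <= g x) ->
  (\int[P]_(x in A) (u x * f x)%:E = \int[P]_(x in A) (u x * g x)%:E)%E.
Proof.
move=> fg GA mu u0 mf f0 g0.
have mA := GT GA.
have E (h : T -> R) : (\int[P]_(x in A) (u x * h x)%:E =
    \int[P]_x (u x * \1_A x * h x)%:E)%E.
  under [RHS]eq_integral do rewrite mulrAC.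
  by rewrite integral_mul_indic setTI.
rewrite !E; apply: integral_condexp_mul => //; last by move=> x;
  rewrite mulr_ge0.
by apply: measurable_wrtM => //; exact: measurable_wrt_indic.
Qed.


End sub_sigma_algebra.

(** * The weighted Doob inequality *)

Lemma measurable_fun_powRr (R : realType) (d : measure_display)
    (T : measurableType d) (f : T -> R) (r : R) :
  measurable_fun setT f -> measurable_fun setT (fun x => f x `^ r).
Proof. by move=> mf; exact: (measurableT_comp (measurable_powR r)). Qed.

(** * Elementary inequalities for powers *)

Section power_inequalities.
Context (R : realType) (q : R).
Hypothesis q1 : 1 < q.

Lemma powRB1_mul (x : R) : 0 <= x -> x `^ (q - 1) * x = x `^ q.
Proof.
by move=> x0; rewrite mulrC mulr_powRB1//; exact: lt_trans q1.
Qed.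

(** Young's inequality for [x] and [y^(q-1)] with exponents [q] and [q / (q - 1)], rearranged. *)
Lemma powRB_le (x y : R) : 0 <= y -> y <= x ->
  x `^ q - y `^ q <= q / (q - 1) * (x `^ (q - 1) - y `^ (q - 1)) * x.
Proof.
move=> y0 yx; have x0 := le_trans y0 yx.
have q0 : 0 < q := lt_trans ltr01 q1.
have q10 : 0 < q - 1 by rewrite subr_gt0.
have := @conjugate_powR R x (y `^ (q - 1)) q (q / (q - 1)) x0 (powR_ge0 _ _) q0.
rewrite divr_gt0// -powRrM => /(_ isT).
have -> : q^-1 + (q / (q - 1))^-1 = 1 by field; rewrite !gt_eqF.
have -> : (q - 1) * (q / (q - 1)) = q by field; rewrite gt_eqF.
move=> /(_ erefl) H.
rewrite -mulrA mulrBl powRB1_mul//.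
have -> : x `^ q - y `^ q =
    q / (q - 1) * (x `^ q - (x `^ q / q + y `^ q / (q / (q - 1)))).
  by field; rewrite !gt_eqF.
apply: ler_wpM2l; first by rewrite divr_ge0// ltW.
by rewrite lerD2l lerN2 mulrC.
Qed.

(** The product is at most the [q]-th power of the larger factor. This crude form of Young's
    inequality suffices for the absorption argument. *)
Lemma powRB1_mul_le (x z : R) : 0 <= x -> 0 <= z ->
  x `^ (q - 1) * z <= x `^ q + z `^ q.
Proof.
move=> x0 z0; have [zx|xz] := leP z x.
  rewrite (@le_trans _ _ (x `^ q))// ?lerDl ?powR_ge0//.
  by rewrite -(powRB1_mul x0) ler_wpM2l// powR_ge0.
rewrite (@le_trans _ _ (z `^ q))// ?lerDr ?powR_ge0//.
rewrite -(powRB1_mul z0) ler_wpM2r//.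
by apply: ge0_ler_powR; rewrite ?nnegrE// ?ltW// subr_gt0.
Qed.

End power_inequalities.

(** * Bounds for integrals of increasing limits *)

Section integral_limit.
Context (R : realType) (d : measure_display) (T : measurableType d)
  (P : probability T R).
Local Open Scope ereal_scope.

(** Monotone convergence, used both to remove a truncation and to let the finite horizon tend to
    infinity. *)
Lemma integral_le_of_approx (phi : nat -> T -> \bar R) (psi : T -> \bar R)
    (B : \bar R) :
  (forall n, measurable_fun setT (phi n)) -> measurable_fun setT psi ->
  (forall n x, 0 <= phi n x) -> (forall x, 0 <= psi x) ->
  (forall x, nondecreasing_seq (phi ^~ x)) ->
  (forall x, psi x <= limn (phi ^~ x)) ->
  (forall n, \int[P]_x phi n x <= B) -> \int[P]_x psi x <= B.
Proof.
move=> mphi mpsi phi0 psi0 ndphi psile phile.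
have cphi x : cvgn (phi ^~ x) by exact: ereal_nondecreasing_is_cvgn.
apply: (@le_trans _ _ (\int[P]_x limn (phi ^~ x))).
  apply: ge0_le_integral => //.
  by apply: emeasurable_fun_cvg => // x _; exact: cphi.
rewrite monotone_convergence//.
apply: lime_le; last exact: nearW.
apply: ereal_nondecreasing_is_cvgn => m n mn.
by apply: ge0_le_integral => // x _; exact: ndphi.
Qed.

End integral_limit.

(** * Running maxima of sequences of functions *)

Fixpoint running_max (R : realType) (T : Type) (h : nat -> T -> R) (n : nat)
    (x : T) : R :=
  if n is n'.+1 then Num.max (running_max h n' x) (h n x) else h 0 x.

Section running_max.
Context (R : realType) (T : Type).
Implicit Types h : nat -> T -> R.

Lemma running_max_ge0 h n x : (forall i y, 0 <= h i y) -> 0 <= running_max h n x.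
Proof. by move=> h0; case: n => [|n] /=; rewrite ?le_max h0 ?orbT. Qed.

Lemma running_max_le h n x (a : R) :
  (running_max h n x <= a) <-> (forall i, (i <= n)%N -> h i x <= a).
Proof.
elim: n => [|n IH] /=.
  by split=> [ha i|]; [rewrite leqn0 => /eqP -> | exact].
rewrite ge_max; split=> [/andP[/IH ha hn] i|ha].
  by rewrite leq_eqVlt => /orP[/eqP -> //|]; rewrite ltnS => /ha.
by rewrite ha// andbT; apply/IH => i ni; apply: ha; exact: leqW.
Qed.

Lemma le_running_max h n i x : (i <= n)%N -> h i x <= running_max h n x.
Proof. by move: i; exact/running_max_le. Qed.

Lemma running_max_nd h x : nondecreasing_seq (fun n => running_max h n x).
Proof. by apply/nondecreasing_seqP => n /=; rewrite le_max lexx. Qed.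

Lemma running_max_min h (K : R) n x :
  running_max (fun i y => Num.min (h i y) K) n x = Num.min (running_max h n x) K.
Proof. by elim: n => [//|n /= ->]; rewrite min_maxl. Qed.

Lemma running_max_powR h (r : R) n x : 0 <= r -> (forall i y, 0 <= h i y) ->
  running_max (fun i y => h i y `^ r) n x = running_max h n x `^ r.
Proof.
move=> r0 h0; elim: n => [//|n /= ->].
have rm0 := running_max_ge0 n x h0.
have [le|/ltW le] := leP (running_max h n x) (h n.+1 x).
  by rewrite max_r//; apply: ge0_ler_powR; rewrite ?nnegrE.
by rewrite max_l//; apply: ge0_ler_powR; rewrite ?nnegrE.
Qed.

End running_max.

(** * Doob's inequality in [L^q] of the measure [v dP], up to a finite horizon *)

Section weighted_doob.
Context (R : realType) (d : measure_display) (T : measurableType d)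
  (P : probability T R) (F : nat -> set (set T)).
Hypothesis sF : forall n, sigma_algebra setT (F n).
Hypothesis FT : forall n, F n `<=` measurable.
Hypothesis Fnd : forall m n, (m <= n)%N -> F m `<=` F n.
Variables (v g : T -> R) (q : R) (N : nat).
Hypothesis q1 : 1 < q.
Hypotheses (mv : measurable_fun setT v) (v0 : forall x, 0 <= v x)
  (iv : P.-integrable setT (EFin \o v)).
Hypotheses (mg : measurable_fun setT g) (g0 : forall x, 0 <= g x).

Let adapted (h : nat -> T -> R) :=
  forall n, (n <= N)%N -> measurable_wrt (F n) (h n).

Lemma measurable_wrt_running_max (h : nat -> T -> R) n : adapted h ->
  (n <= N)%N -> measurable_wrt (F n) (running_max h n).
Proof.
move=> ah; elim: n => [|n IH] nN /=; first exact: ah.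
apply: (measurable_wrt_max (sF n.+1)).
  by move=> B mB; apply: (Fnd (leqnSn n)); exact: IH (ltnW nN) _ mB.
exact: ah.
Qed.

(** Expresses that [h n] is at most the conditional expectation of [g] for [v dP], through integrals
    against [P] only. *)
Let dominated (h : nat -> T -> R) := forall n, (n <= N)%N ->
  forall A, F n A ->
  (\int[P]_(x in A) (h n x * v x)%:E <= \int[P]_(x in A) (g x * v x)%:E)%E.

(** Summation by parts, carried out as an induction on [n]: each increment of the [q]-th power of
    the maximum is paid for by [h n.+1], which domination replaces by [g], and the increments of the
    [(q-1)]-th power telescope. *)
Lemma integral_running_max_le (h : nat -> T -> R) n : adapted h ->
  (forall i x, 0 <= h i x) -> dominated h -> (n <= N)%N ->
  (\int[P]_x (running_max h n x `^ q * v x)%:E <=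
   \int[P]_x (q / (q - 1) * running_max h n x `^ (q - 1) * (g x * v x))%:E)%E.
Proof.
move=> ah h0 dh.
have q0 : 0 < q := lt_trans ltr01 q1.
have q10 : 0 < q - 1 by rewrite subr_gt0.
have qq0 : 0 <= q / (q - 1) by rewrite divr_ge0 ?ltW.
have mh i : (i <= N)%N -> measurable_fun setT (h i).
  by move=> iN; exact: (measurable_wrt_measurable_fun (@FT i) (ah _ iN)).
have mgv : measurable_fun setT (fun x => g x * v x) by exact: measurable_funM.
have gv0 x : 0 <= g x * v x by rewrite mulr_ge0.
have mm i : (i <= N)%N -> measurable_fun setT (running_max h i).
  move=> iN; exact: (measurable_wrt_measurable_fun (@FT i)
    (measurable_wrt_running_max ah iN)).
have m0 i x : 0 <= running_max h i x by exact: running_max_ge0.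
have transfer i (u : T -> R) : (i <= N)%N -> measurable_wrt (F i) u ->
    (forall x, 0 <= u x) ->
    (\int[P]_x (u x * (h i x * v x))%:E <= \int[P]_x (u x * (g x * v x))%:E)%E.
  move=> iN mu u0; apply: (le_integral_mul (sF i) (@FT i)) => //.
  - by apply: measurable_funM => //; exact: mh.
  - by move=> x; rewrite mulr_ge0.
  - by move=> A FA; exact: dh.
elim: n => [|n IH] nN.
  (* At time 0 the factor [q / (q - 1)] can be inserted because it is at least 1. *)
  apply: le_trans (transfer 0%N (fun x => q / (q - 1) * h 0%N x `^ (q - 1)) _ _ _) => //.
  - apply: ge0_le_integral => //=.
    + by move=> x _; rewrite lee_fin mulr_ge0// powR_ge0.
    + by apply/measurable_EFinP/measurable_funM => //;
        exact/measurable_fun_powRr/mh.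
    + apply/measurable_EFinP/measurable_funM;
        last by apply: measurable_funM => //; exact: mh.
      by apply: measurable_funM => //; exact/measurable_fun_powRr/mh.
    + move=> x _; rewrite lee_fin !mulrA ler_wpM2r// -mulrA powRB1_mul//.
      by rewrite ler_peMl ?powR_ge0// ler_pdivlMr// mul1r gerBl ler01.
  - apply: (measurable_wrtM (sF _)); first exact: (measurable_wrt_cst (sF _)).
    by apply: measurable_wrt_powR; exact: ah.
  - by move=> x; rewrite mulr_ge0// powR_ge0.
(* This increment is zero unless [h n.+1] exceeds the earlier maximum; therefore the factor [x] in
   [powRB_le] can be taken to be [h n.+1]. *)
pose u x := q / (q - 1) * (running_max h n.+1 x `^ (q - 1) - running_max h n x `^ (q - 1)).
have mu : measurable_wrt (F n.+1) u.
  apply: (measurable_wrtM (sF _)); first exact: (measurable_wrt_cst (sF _)).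
  apply: (measurable_wrtB (sF _)); apply: measurable_wrt_powR.
    exact: measurable_wrt_running_max.
  move=> B mB; apply: (Fnd (leqnSn n)).
  by apply: (measurable_wrt_running_max ah _ mB); exact: ltnW.
have u0 x : 0 <= u x.
  rewrite mulr_ge0// subr_ge0 ge0_ler_powR ?nnegrE//; first exact: ltW.
  exact: running_max_nd.
have mu' := measurable_wrt_measurable_fun (@FT _) mu.
have nN' := ltnW nN.
apply: (@le_trans _ _ (\int[P]_x ((running_max h n x `^ q * v x)%:E +
    (u x * (h n.+1 x * v x))%:E))%E).
  apply: ge0_le_integral => //.
  + by move=> x _; rewrite lee_fin mulr_ge0// powR_ge0.
  + by apply/measurable_EFinP/measurable_funM => //;
      exact/measurable_fun_powRr/mm.
  + apply: emeasurable_funD; apply/measurable_EFinP.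
      by apply: measurable_funM => //; exact/measurable_fun_powRr/mm.
    by do 2 apply: measurable_funM => //; exact: mh.
  + move=> x _;
      rewrite -EFinD lee_fin mulrA -mulrDl ler_wpM2r// addrC -lerBlDr /u /=.
    have [le|/ltW le] := leP (running_max h n x) (h n.+1 x).
      by apply: powRB_le.
    by rewrite !subrr mulr0 mul0r lexx.
rewrite ge0_integralD//; last 4 first.
  + by move=> x _; rewrite lee_fin mulr_ge0// powR_ge0.
  + by apply/measurable_EFinP/measurable_funM => //;
      exact/measurable_fun_powRr/mm.
  + by move=> x _; rewrite lee_fin mulr_ge0// mulr_ge0.
  + by apply/measurable_EFinP; do 2 apply: measurable_funM => //; exact: mh.
apply: (@le_trans _ _ _ _ _ (leeD (IH nN') (transfer _ _ nN mu u0))).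
rewrite -ge0_integralD//; last 4 first.
  + by move=> x _; rewrite lee_fin mulr_ge0// mulr_ge0 ?powR_ge0.
  + by apply/measurable_EFinP/measurable_funM => //;
      apply: measurable_funM => //; exact/measurable_fun_powRr/mm.
  + by move=> x _; rewrite lee_fin mulr_ge0.
  + by apply/measurable_EFinP; apply: measurable_funM.
rewrite le_eqVlt; apply/orP; left; apply/eqP; apply: eq_integral => x _.
rewrite -EFinD -mulrDl /u; congr (_ * _)%:E; ring.
Qed.

(* The bound on [h] makes the left-hand side finite, so that half of it can be
   absorbed after [powRB1_mul_le]; it is removed by truncation in the next lemma. *)
Lemma bounded_doob (h : nat -> T -> R) (K : R) : adapted h ->
  (forall i x, 0 <= h i x) -> (forall i x, h i x <= K) -> dominated h ->
  (\int[P]_x (running_max h N x `^ q * v x)%:E <=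
   ((2 * (q / (q - 1))) `^ q)%:E * \int[P]_x (g x `^ q * v x)%:E)%E.
Proof.
move=> ah h0 hK dh.
have q0 : 0 < q := lt_trans ltr01 q1.
have q10 : 0 < q - 1 by rewrite subr_gt0.
have c0 : 0 <= q / (q - 1) by rewrite divr_ge0 ?ltW.
set c := q / (q - 1) in c0 *.
set m := running_max h N.
have mm : measurable_fun setT m.
  exact: (measurable_wrt_measurable_fun (@FT N)
    (measurable_wrt_running_max ah (leqnn N))).
have m0 x : 0 <= m x by exact: running_max_ge0.
have cm0 x : 0 <= c * m x `^ (q - 1) by rewrite mulr_ge0// powR_ge0.
have gv0 x : 0 <= g x * v x by rewrite mulr_ge0.
pose I := (\int[P]_x (m x `^ q * v x)%:E)%E.
pose J := (\int[P]_x ((2 * c * g x) `^ q * v x)%:E)%E.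
have mI : measurable_fun setT (fun x => (m x `^ q * v x)%:E).
  by apply/measurable_EFinP/measurable_funM => //; exact: measurable_fun_powRr.
have mJ : measurable_fun setT (fun x => ((2 * c * g x) `^ q * v x)%:E).
  apply/measurable_EFinP/measurable_funM => //; apply: measurable_fun_powRr.
  exact: measurable_funM.
have I0 : (0 <= I)%E by apply: integral_ge0 => x _;
  rewrite lee_fin mulr_ge0 ?powR_ge0.
have Ifin : I \is a fin_num.
  rewrite ge0_fin_numE//.
  have /integrableP[_ ivoo] := iv.
  apply: (@le_lt_trans _ _ (\int[P]_x ((K `^ q)%:E * `|(v x)%:E|))%E).
    apply: ge0_le_integral => //.
    + by move=> x _; rewrite lee_fin mulr_ge0 ?powR_ge0.
    + apply: emeasurable_funM => //; apply: measurableT_comp => //;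
        exact/measurable_EFinP.
    + move=> x _; rewrite -EFinM lee_fin ger0_norm// ler_wpM2r//.
      have mK : m x <= K by apply/running_max_le.
      apply: ge0_ler_powR; rewrite ?nnegrE//; first exact: ltW.
      exact: le_trans (m0 x) mK.
  rewrite ge0_integralZl//; last 2 first.
  + by apply: measurableT_comp => //; exact/measurable_EFinP.
  + by rewrite lee_fin powR_ge0.
  by apply: lte_mul_pinfty => //; rewrite ?lee_fin ?powR_ge0.
(* Twice the bound of [integral_running_max_le] has the integrand [m^(q-1) * (2 * c * g) * v], which
   [powRB1_mul_le] splits into the integrands of [I] and [J]. *)
have IIJ : (2%:E * I <= I + J)%E.
  rewrite -ge0_integralZl//; last by move=> x _;
    rewrite lee_fin mulr_ge0 ?powR_ge0.
  rewrite -ge0_integralD//; last 2 first.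
  + by move=> x _; rewrite lee_fin mulr_ge0 ?powR_ge0.
  + by move=> x _; rewrite lee_fin mulr_ge0 ?powR_ge0.
  have := integral_running_max_le ah h0 dh (leqnn N).
  rewrite -/m -/c => H.
  rewrite ge0_integralZl//; last by move=> x _;
    rewrite lee_fin mulr_ge0 ?powR_ge0.
  have /le_trans : (2%:E * I <= 2%:E * \int[P]_x (c * m x `^ (q - 1) * (g x * v x))%:E)%E.
    by rewrite lee_pmul2l.
  apply; rewrite -ge0_integralZl//; last 2 first.
  + apply/measurable_EFinP; apply: measurable_funM; last exact: measurable_funM.
    by apply: measurable_funM => //; exact: measurable_fun_powRr.
  + by move=> x _; rewrite lee_fin mulr_ge0.
  apply: ge0_le_integral => //.
  + by move=> x _; rewrite -EFinM lee_fin mulr_ge0// mulr_ge0.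
  + apply: emeasurable_funM => //.
    apply/measurable_EFinP; apply: measurable_funM; last exact: measurable_funM.
    by apply: measurable_funM => //; exact: measurable_fun_powRr.
  + exact: emeasurable_funD.
  + move=> x _; rewrite -EFinM -EFinD lee_fin -mulrDl.
    have -> : 2 * (c * m x `^ (q - 1) * (g x * v x)) =
        m x `^ (q - 1) * (2 * c * g x) * v x by ring.
    by rewrite ler_wpM2r// powRB1_mul_le// mulr_ge0// mulr_ge0.
(* One copy of the finite [I] is subtracted; an infinite [J] is trivial. *)
have IJ : (I <= J)%E.
  have : (0 <= J)%E.
    by apply: integral_ge0 => x _; rewrite lee_fin mulr_ge0 ?powR_ge0.
  move: IIJ; rewrite -(fineK Ifin); case: J => [j II _|_ _|//].
    by move: II; rewrite -EFinM -EFinD !lee_fin => ?; lra.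
  by rewrite leey.
apply: (le_trans IJ); rewrite /J -ge0_integralZl//; last 3 first.
- by apply/measurable_EFinP/measurable_funM => //; exact: measurable_fun_powRr.
- by move=> x _; rewrite lee_fin mulr_ge0 ?powR_ge0.
- by rewrite lee_fin powR_ge0.
rewrite le_eqVlt; apply/orP; left; apply/eqP; apply: eq_integral => x _.
have c20 : 0 <= 2 * c by rewrite mulr_ge0.
by rewrite -EFinM (powRM _ c20 (g0 x)) -mulrA.
Qed.

(** The truncations of [h] at height [K] remain adapted and dominated, and their running maxima
    increase with [K] to that of [h], so the bounded case passes to the limit. *)
Lemma weighted_doob (h : nat -> T -> R) : adapted h ->
  (forall i x, 0 <= h i x) -> dominated h ->
  (\int[P]_x (running_max h N x `^ q * v x)%:E <=
   ((2 * (q / (q - 1))) `^ q)%:E * \int[P]_x (g x `^ q * v x)%:E)%E.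
Proof.
move=> ah h0 dh.
have q0 : 0 < q := lt_trans ltr01 q1.
have mh i : (i <= N)%N -> measurable_fun setT (h i).
  by move=> iN; exact: (measurable_wrt_measurable_fun (@FT i) (ah _ iN)).
have mm : measurable_fun setT (running_max h N).
  exact: (measurable_wrt_measurable_fun (@FT N)
    (measurable_wrt_running_max ah (leqnn N))).
have m0 x : 0 <= running_max h N x by exact: running_max_ge0.
have min0 (K : nat) x : 0 <= Num.min (running_max h N x) K%:R.
  by rewrite le_min m0/= ler0n.
have ndu x : nondecreasing_seq
    (fun K : nat => (Num.min (running_max h N x) K%:R `^ q * v x)%:E).
  move=> i j ij; rewrite lee_fin ler_wpM2r//.
  apply: ge0_ler_powR; rewrite ?nnegrE//; first exact: ltW.
  by rewrite le_min ge_min lexx/= ge_min ler_nat ij orbT.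
apply: (@integral_le_of_approx _ _ _ P
  (fun K x => (Num.min (running_max h N x) K%:R `^ q * v x)%:E)).
- move=> K; apply/measurable_EFinP/measurable_funM => //;
    apply: measurable_fun_powRr.
  exact: measurable_minr.
- by apply/measurable_EFinP/measurable_funM => //; exact: measurable_fun_powRr.
- by move=> K x; rewrite lee_fin mulr_ge0 ?powR_ge0.
- by move=> x; rewrite lee_fin mulr_ge0 ?powR_ge0.
- by [].
- move=> x.
  set u := (X in limn X).
  (* At a fixed point the truncation is inactive once [K] exceeds the running maximum, so the limit
     is reached at a finite index. *)
  have -> : (running_max h N x `^ q * v x)%:E =
      u (Num.truncn (running_max h N x)).+1.
    by rewrite /u min_l//; apply: ltW; exact: Num.Theory.truncnS_gt.
  apply: lime_ge; last first.
    exists (Num.truncn (running_max h N x)).+1 => // j ij; exact: ndu.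
  by apply: ereal_nondecreasing_is_cvgn => i j ij; exact: ndu.
- move=> K.
  under eq_integral do rewrite -running_max_min.
  apply: (@bounded_doob _ K%:R).
  + move=> n nN; apply: (measurable_wrt_min (sF _)); first exact: ah.
    exact: (measurable_wrt_cst (sF _)).
  + by move=> i x; rewrite le_min h0 ler0n.
  + by move=> i x; rewrite ge_min lexx orbT.
  + move=> n nN A FA; apply: le_trans (dh n nN A FA).
    have mA := FT FA.
    apply: ge0_le_integral => //.
    * by move=> x _; rewrite lee_fin mulr_ge0// le_min h0 ler0n.
    * apply/measurable_EFinP/measurable_funM; last exact: measurable_funTS.
      by apply: measurable_minr => //; apply: measurable_funTS; exact: mh.
    * apply/measurable_EFinP/measurable_funM; last exact: measurable_funTS.
      by apply: measurable_funTS; exact: mh.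
    * by move=> x _; rewrite lee_fin ler_wpM2r// ge_min lexx.
Qed.

End weighted_doob.

(** * The A_p condition *)

Section dual_exponents.
Context (R : realType) (p w : R).
Hypotheses (p1 : 1 < p) (w0 : 0 < w).
Let s := w `^ (- (p - 1)^-1).

(** Makes the [p]-th power of the [L^p(w)] norm of the dual weight on a set equal to its integral
    there. *)
Lemma dual_powR_mul : s `^ p * w = s.
Proof.
have p10 : p - 1 != 0 by rewrite subr_eq0 gt_eqF.
rewrite /s -powRrM -[X in _ * X]powRr1 ?ltW// -powRD;
  last by rewrite (gt_eqF w0) implybT.
by congr (_ `^ _); field.
Qed.

Lemma dual_powRB1_mul : s `^ (p - 1) * w = 1.
Proof.
have p10 : p - 1 != 0 by rewrite subr_eq0 gt_eqF.
rewrite /s -powRrM mulNr mulVf// -[X in _ * X]powRr1 ?ltW// -powRD;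
  last by rewrite (gt_eqF w0) implybT.
by rewrite addNr powRr0.
Qed.

(** Dividing by the dual weight is thus an isometry from [L^p(w)] to [L^p] of the dual weight. *)
Lemma div_dual_powR_mul a : 0 <= a -> (a / s) `^ p * s = a `^ p * w.
Proof.
move=> a0; have p10 : p - 1 != 0 by rewrite subr_eq0 gt_eqF.
rewrite /s -powRN opprK powRM ?powR_ge0// -powRrM -mulrA -powRD;
  last by rewrite (gt_eqF w0) implybT.
by congr (_ * _); rewrite -[RHS]powRr1 ?ltW//; congr (_ `^ _); field.
Qed.

(** With [q = p / (p - 1)], this rests on [(p - 1) q = p] and [w^(1-q) = s]. It evaluates the
    right-hand side of Doob's inequality for [w dP]. *)
Lemma conj_powR_mul c a : 0 <= c -> 0 <= a ->
  (c * a `^ (p - 1) / w) `^ (p / (p - 1)) * w = c `^ (p / (p - 1)) * (a `^ p * s).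
Proof.
move=> c0 a0; have p10 : p - 1 != 0 by rewrite subr_eq0 gt_eqF.
have wi0 : 0 <= w^-1 by rewrite invr_ge0 ltW.
rewrite powRM ?mulr_ge0 ?powR_ge0// powRM ?powR_ge0// -powRrM.
have -> : (p - 1) * (p / (p - 1)) = p by field.
rewrite -!mulrA; congr (_ * (_ * _)).
rewrite -powR_inv1 ?ltW// -powRrM -[X in _ * X]powRr1 ?ltW// -powRD;
  last by rewrite (gt_eqF w0) implybT.
by congr (_ `^ _); field.
Qed.

End dual_exponents.

(** * The Doob maximal function as a limit of running maxima *)

Section maximal_function.
Context (R : realType) (d : measure_display) (T : measurableType d)
  (P : probability T R) (F : nat -> set (set T)).
Hypothesis fsF : filtered_space P F.
Let sF := fs_sigma fsF.
Let FT := fs_sub fsF.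

Lemma measurable_condexp n (f : T -> R) :
  measurable_fun setT (condexp P (F n) f).
Proof.
by apply: (measurable_wrt_measurable_fun (@FT n));
  exact: measurable_wrt_condexp.
Qed.

Lemma doob_max_ge0 (f : T -> R) x : (0 <= doob_max P F f x)%E.
Proof.
apply: (@le_trans _ _ (`|condexp P (F 0) f x|)%:E); first by rewrite lee_fin.
by apply: ereal_sup_ubound; exists 0%N.
Qed.

Lemma measurable_doob_max (f : T -> R) : measurable_fun setT (doob_max P F f).
Proof.
rewrite (_ : doob_max P F f = fun x => esups (fun n => (`|condexp P (F n) f x|)%:E) 0%N).
  apply: measurable_fun_esups => n; apply/measurable_EFinP.
  by apply: measurableT_comp => //; exact: measurable_condexp.
apply/funext => x; rewrite /doob_max /esups /sdrop; congr ereal_sup.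
by apply/seteqP; split=> _ [n _ <-]; exists n.
Qed.

(** If the limit is a finite [l], every term is at most [(l / w x)^(1/p)], hence so is the supremum;
    an infinite limit is trivial. *)
Lemma doob_max_le_lim (p : R) (w : T -> R) (f : T -> R) x : 0 < p -> 0 < w x ->
  (doob_max P F f x `^ p * (w x)%:E <=
   limn (fun N => (running_max (fun n y => `|condexp P (F n) f y|) N x `^ p * w x)%:E))%E.
Proof.
move=> p0 wx0.
set a := fun n y => `|condexp P (F n) f y|.
set u := (X in limn X).
have a0 N : 0 <= running_max a N x by apply: running_max_ge0 => i y;
  exact: normr_ge0.
have ndu : nondecreasing_seq u.
  move=> i j ij; rewrite lee_fin ler_wpM2r//; first exact: ltW.
  apply: ge0_ler_powR; rewrite ?nnegrE//; first exact: ltW.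
  exact: running_max_nd.
have cu : cvgn u by exact: ereal_nondecreasing_is_cvgn.
have uL N : (u N <= limn u)%E.
  by apply: lime_ge => //; exists N => // j; exact: ndu.
have : (0 <= limn u)%E.
  by apply: le_trans (uL 0%N); rewrite lee_fin mulr_ge0 ?powR_ge0// ltW.
case: (limn u) uL => [l uL l0|_ _|//]; last by rewrite leey.
have lw0 : 0 <= l / w x by rewrite divr_ge0// ltW.
have aN N : a N x <= (l / w x) `^ p^-1.
  apply: le_trans (le_running_max a x (leqnn N)) _.
  rewrite -[leLHS]powRr1// -(@divff _ p) ?gt_eqF// powRrM.
  apply: ge0_ler_powR; rewrite ?nnegrE ?powR_ge0//.
    by rewrite invr_ge0 ltW.
  by rewrite ler_pdivlMr// -lee_fin; exact: uL.
have D : (doob_max P F f x <= ((l / w x) `^ p^-1)%:E)%E.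
  by apply: ge_ereal_sup => _ [n _ <-]; rewrite lee_fin; exact: aN.
apply: (@le_trans _ _ (((l / w x) `^ p^-1)%:E `^ p * (w x)%:E)%E).
  apply: lee_wpmul2r; first by rewrite lee_fin ltW.
  apply: gt0_ler_poweR => //; first exact: ltW.
    by rewrite in_itv/= doob_max_ge0 leey.
  by rewrite in_itv/= lee_fin powR_ge0 leey.
rewrite poweR_EFin -EFinM lee_fin -powRrM mulVf ?gt_eqF// powRr1// divfK// gt_eqF//.
Qed.

End maximal_function.

(** * Both implications for [p]-th powers of norms and an everywhere positive weight *)

Section positive_weight.
Context (R : realType) (d : measure_display) (T : measurableType d)
  (P : probability T R) (F : nat -> set (set T)) (p : R) (w : T -> R).
Hypothesis fsF : filtered_space P F.
Let sF := fs_sigma fsF.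
Let FT := fs_sub fsF.
Let Fnd := fs_incr fsF.
Hypothesis p1 : 1 < p.
Hypothesis w0 : forall x, 0 < w x.
Hypothesis iw : P.-integrable setT (EFin \o w).
Let s := dual_weight p w.
Hypothesis isg : P.-integrable setT (EFin \o s).

Let p0 : 0 < p. Proof. exact: lt_trans p1. Qed.
Let pB1_gt0 : 0 < p - 1. Proof. by rewrite subr_gt0. Qed.
Let mw : measurable_fun setT w.
Proof. by apply/measurable_EFinP; exact: measurable_int iw. Qed.
Let ms : measurable_fun setT s.
Proof. by apply/measurable_EFinP; exact: measurable_int isg. Qed.
Let s0 x : 0 < s x. Proof. by rewrite /s /dual_weight powR_gt0. Qed.
Let w0W x : 0 <= w x. Proof. exact: ltW. Qed.
Let s0W x : 0 <= s x. Proof. exact: ltW. Qed.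

(** The pointwise bound by [|f|^p w + s] holds: where [|f|] exceeds [s], the factor [|f|^(p-1) w] is
    at least [s^(p-1) w = 1]. *)
Lemma wLp_integrable (f : T -> R) : measurable_fun setT f ->
  (\int[P]_x (`|f x| `^ p * w x)%:E < +oo)%E ->
  P.-integrable setT (EFin \o f).
Proof.
move=> mf foo; apply/integrableP; split; first exact/measurable_EFinP.
have mabs : measurable_fun setT (fun x => `|f x|) by exact: measurableT_comp.
have mfw : measurable_fun setT (fun x => `|f x| `^ p * w x).
  by apply: measurable_funM => //; exact: measurable_fun_powRr.
apply: (@le_lt_trans _ _ (\int[P]_x ((`|f x| `^ p * w x)%:E + (s x)%:E))%E).
  apply: ge0_le_integral => //.
  - by apply: measurableT_comp => //; exact/measurable_EFinP.
  - by apply: emeasurable_funD; exact/measurable_EFinP.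
  move=> x _; rewrite /= -EFinD lee_fin.
  have [fs|/ltW sf] := leP `|f x| (s x).
    by apply: le_trans fs _; rewrite lerDr mulr_ge0 ?powR_ge0.
  apply: (@le_trans _ _ (`|f x| `^ p * w x)); last by rewrite lerDl.
  rewrite -(@powRB1_mul _ _ p1)// mulrAC ler_peMl//.
  rewrite -[leLHS](dual_powRB1_mul p1 (w0 x)) ler_wpM2r//.
  by apply: ge0_ler_powR; rewrite ?nnegrE ?powR_ge0//; exact: ltW.
rewrite ge0_integralD//; last 4 first.
- by move=> x _; rewrite lee_fin mulr_ge0 ?powR_ge0.
- exact/measurable_EFinP.
- by move=> x _; rewrite lee_fin.
- exact/measurable_EFinP.
apply: lte_add_pinfty => //.
have /integrableP[_] := isg.
by apply: le_lt_trans; apply: ge0_le_integral => //; [move=> x _;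
  rewrite lee_fin
  | exact/measurable_EFinP
  | by apply: measurableT_comp => //; exact/measurable_EFinP
  | move=> x _; rewrite lee_fin ler_norm].
Qed.

(** Two uses of [weighted_doob], linked by the running maximum [m] of the quotients [fn / sn]. *)
Lemma running_max_Ap_bound (f : T -> R) (c : R) (fn : nat -> T -> R) N :
  0 <= c -> P.-integrable setT (EFin \o f) -> (forall x, 0 <= f x) ->
  (forall n, {ae P, forall x,
    condexp P (F n) w x * condexp P (F n) s x `^ (p - 1) <= c}) ->
  (forall n, is_condexp P (F n) f (fn n)) -> (forall n x, 0 <= fn n x) ->
  (\int[P]_x (running_max fn N x `^ p * w x)%:E <=
   ((2 * (p / (p - 1) / (p / (p - 1) - 1))) `^ (p / (p - 1)))%:E *
   ((c `^ (p / (p - 1)))%:E *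
   (((2 * (p / (p - 1))) `^ p)%:E * \int[P]_x (f x `^ p * w x)%:E)))%E.
Proof.
move=> c0 if_ f0 Ap fnE fn0.
set q := p / (p - 1).
have q1 : 1 < q by rewrite /q ltr_pdivlMr// mul1r gtrBl.
have mf : measurable_fun setT f by apply/measurable_EFinP;
  exact: measurable_int if_.
have /choice[wn] : forall n, exists g, is_condexp P (F n) w g /\ forall x, 0 < g x.
  by move=> n; exact: (is_condexp_gt0_version (sF n) (@FT n)).
move=> /all_and2[wnE wn0].
have /choice[sn] : forall n, exists g, is_condexp P (F n) s g /\ forall x, 0 < g x.
  by move=> n; exact: (is_condexp_gt0_version (sF n) (@FT n)).
move=> /all_and2[snE sn0].
have wn0W n x : 0 <= wn n x by exact: ltW.
have sn0W n x : 0 <= sn n x by exact: ltW.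
have mfn n : measurable_wrt (F n) (fn n) by case: (fnE n).
have mwn n : measurable_wrt (F n) (wn n) by case: (wnE n).
have msn n : measurable_wrt (F n) (sn n) by case: (snE n).
have Apn n : {ae P, forall x, wn n x * sn n x `^ (p - 1) <= c}.
  have h1 := is_condexp_ae_eq (sF n) (@FT n) iw
    (is_condexp_condexp (sF n) (@FT n) iw) (wnE n).
  have h2 := is_condexp_ae_eq (sF n) (@FT n) isg
    (is_condexp_condexp (sF n) (@FT n) isg) (snE n).
  by apply: filterS3 h1 h2 (Ap n) => x -> ->.
(* The quotient is written with the power [-1] so that measurability follows from products and
   powers. *)
pose h n x := fn n x * sn n x `^ (-1).
have h0 n x : 0 <= h n x by rewrite mulr_ge0 ?powR_ge0.
have mh n : measurable_wrt (F n) (h n).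
  by apply: (measurable_wrtM (sF n)) => //; exact: measurable_wrt_powR.
have hsn n x : h n x * sn n x = fn n x.
  by rewrite /h powR_inv1// divfK// gt_eqF.
have mgs : measurable_fun setT (fun x => f x / s x).
  rewrite (_ : (fun _ => _) = fun x => f x * s x `^ (-1)).
    by apply: measurable_funM => //; exact: measurable_fun_powRr.
  by apply/funext => x; rewrite powR_inv1.
have mfnT n := measurable_wrt_measurable_fun (@FT n) (mfn n).
have mwnT n := measurable_wrt_measurable_fun (@FT n) (mwn n).
pose m := running_max h N.
have m0 x : 0 <= m x by exact: running_max_ge0.
have mm : measurable_fun setT m.
  apply: (measurable_wrt_measurable_fun (@FT N)).
  by apply: (measurable_wrt_running_max sF Fnd (N := N)) => // n _; exact: mh.
(* Doob's inequality for [s dP] in [L^p]. Domination holds with equality, since [h n * sn n = fn n]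
   integrates over sets of [F n] like [f = (f / s) * s]. *)
have step1 : (\int[P]_x (m x `^ p * s x)%:E <=
    ((2 * q) `^ p)%:E * \int[P]_x (f x `^ p * w x)%:E)%E.
  rewrite [X in (_ <= _ * X)%E](_ : _ = \int[P]_x ((f x / s x) `^ p * s x)%:E)%E; last first.
    by apply: eq_integral => x _; rewrite (div_dual_powR_mul p1 (w0 x)).
  apply: (weighted_doob sF FT Fnd p1) => //.
  - by move=> x; rewrite divr_ge0.
  move=> n nN A FA.
  rewrite (integral_condexp_mul_in (sF n) (@FT n) (snE n))//.
  rewrite le_eqVlt; apply/orP; left; apply/eqP.
  under eq_integral do rewrite hsn.
  have [_ _ ->//] := fnE n.
  by apply: eq_integral => x _; rewrite divfK// gt_eqF.
(* Doob's inequality for [w dP] in [L^q], where the dominating function [c m^(p-1) / w] has the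
   density of the measure divided out. *)
have step2 :
    (\int[P]_x (running_max (fun n x => fn n x `^ (p - 1)) N x `^ q * w x)%:E <=
    ((2 * (q / (q - 1))) `^ q)%:E * \int[P]_x ((c * m x `^ (p - 1) / w x) `^ q * w x)%:E)%E.
  have mg' : measurable_fun setT (fun x => c * m x `^ (p - 1) / w x).
    rewrite (_ : (fun _ => _) = fun x => c * m x `^ (p - 1) * w x `^ (-1)).
      by apply: measurable_funM; [apply: measurable_funM|] => //;
        exact: measurable_fun_powRr.
    by apply/funext => x; rewrite powR_inv1.
  apply: (weighted_doob sF FT Fnd q1) => //.
  - by move=> x; rewrite divr_ge0 ?mulr_ge0 ?powR_ge0.
  - by move=> n _; exact: measurable_wrt_powR.
  - by move=> n x; exact: powR_ge0.
  move=> n nN A FA; have mA := FT FA.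
  rewrite (integral_condexp_mul_in (sF n) (@FT n) (wnE n))//; last 2 first.
  - exact: measurable_wrt_powR.
  - by move=> x; exact: powR_ge0.
  under [leRHS]eq_integral do rewrite divfK ?gt_eqF//.
  apply: ae_ge0_le_integral => //.
  - by move=> x _; rewrite lee_fin mulr_ge0 ?powR_ge0.
  - apply/measurable_EFinP/measurable_funM; last exact: measurable_funTS.
    by apply: measurable_funTS; exact: measurable_fun_powRr.
  - by move=> x _; rewrite lee_fin mulr_ge0 ?powR_ge0.
  - apply/measurable_EFinP/measurable_funM => //.
    by apply: measurable_funTS; exact: measurable_fun_powRr.
  apply: filterS (Apn n) => x Apx _; rewrite lee_fin.
  (* The product regroups as [h^(p-1)] times [wn * sn^(p-1)]; these are bounded by [m^(p-1)] and
     [c]. *)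
  rewrite -(hsn n x) powRM// mulrAC -mulrA mulrC.
  apply: ler_pM => //; rewrite ?powR_ge0 ?mulr_ge0 ?powR_ge0//.
  apply: ge0_ler_powR; rewrite ?nnegrE//; first exact: ltW.
  exact: le_running_max.
(* As [(p - 1) q = p], the quantity to bound is the left-hand side of [step2]. *)
rewrite (eq_integral (fun x =>
    (running_max (fun n x => fn n x `^ (p - 1)) N x `^ q * w x)%:E));
      last first.
  move=> x _; rewrite running_max_powR//; last exact: ltW.
  rewrite -powRrM (_ : (p - 1) * q = p)// /q mulrCA divff ?mulr1// gt_eqF//.
apply: (le_trans step2); apply: lee_wpmul2l; first by rewrite lee_fin powR_ge0.
apply: (@le_trans _ _ ((c `^ q)%:E * \int[P]_x (m x `^ p * s x)%:E)%E);
  last first.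
  by apply: lee_wpmul2l => //; rewrite lee_fin powR_ge0.
rewrite -ge0_integralZl//; last 3 first.
- by apply/measurable_EFinP/measurable_funM => //; exact: measurable_fun_powRr.
- by move=> x _; rewrite lee_fin mulr_ge0 ?powR_ge0.
- by rewrite lee_fin powR_ge0.
rewrite le_eqVlt; apply/orP; left; apply/eqP; apply: eq_integral => x _.
by rewrite (conj_powR_mul p1 (w0 x) c0 (m0 x)).
Qed.

Let mfw (f : T -> R) : measurable_fun setT f ->
  measurable_fun setT (fun x => (f x `^ p * w x)%:E).
Proof.
by move=> mf; apply/measurable_EFinP/measurable_funM => //;
  exact: measurable_fun_powRr.
Qed.

Let fw0 (f : T -> R) x : (0 <= (f x `^ p * w x)%:E)%E.
Proof. by rewrite lee_fin mulr_ge0 ?powR_ge0. Qed.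

(** The finite-horizon estimate is applied to [|f|], whose conditional expectations dominate those
    of [f] in absolute value almost everywhere; then the horizon tends to infinity. *)
Lemma doob_max_Ap_bound (f : T -> R) (c : R) :
  0 <= c -> measurable_fun setT f ->
  (\int[P]_x (`|f x| `^ p * w x)%:E < +oo)%E ->
  (forall n, {ae P, forall x,
    condexp P (F n) w x * condexp P (F n) s x `^ (p - 1) <= c}) ->
  (\int[P]_x (doob_max P F f x `^ p * (w x)%:E) <=
   ((2 * (p / (p - 1) / (p / (p - 1) - 1))) `^ (p / (p - 1)))%:E *
   ((c `^ (p / (p - 1)))%:E *
   (((2 * (p / (p - 1))) `^ p)%:E * \int[P]_x (`|f x| `^ p * w x)%:E)))%E.
Proof.
move=> c0 mf foo Ap.
have if_ := wLp_integrable mf foo.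
have mabs : measurable_fun setT (fun x => `|f x|) by exact: measurableT_comp.
have iabs : P.-integrable setT (EFin \o (fun x => `|f x|)).
  by have := integrable_abse if_.
have /choice[fn] : forall n, exists g,
    is_condexp P (F n) (fun x => `|f x|) g /\ forall x, 0 <= g x.
  by move=> n; exact: (is_condexp_ge0_version (sF n) (@FT n)).
move=> /all_and2[fnE fn0].
have mfn n := measurable_wrt_measurable_fun (@FT n) (let: And3 m _ _ := fnE n in m).
(* Both [f] and [- f] are at most [|f|], and the countably many exceptional sets are merged into
   one. *)
have afn : {ae P, forall x n, `|condexp P (F n) f x| <= fn n x}.
  apply: ae_foralln => n.
  have cf := is_condexp_condexp (sF n) (@FT n) if_.
  have cNf := is_condexpN (sF n) (@FT n) if_ cf.
  have iNf : P.-integrable setT (EFin \o (fun x => - f x)).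
    rewrite (_ : _ \o _ = \- (EFin \o f))%E; first exact: integrableN.
    by apply/funext => x /=; rewrite EFinN.
  have h1 := is_condexp_ae_le (sF n) (@FT n) cf if_ iabs (fnE n) (fun x => ler_norm _).
  have h2 : {ae P, forall x, - condexp P (F n) f x <= fn n x}.
    apply: (is_condexp_ae_le (sF n) (@FT n) cNf iNf iabs (fnE n)) => x.
    by rewrite -normrN ler_norm.
  move: h1 h2; apply: filterS2 => x h1 h2.
  by rewrite ler_norml h1 andbT lerNl.
pose a n x := `|condexp P (F n) f x|.
have ma n : measurable_fun setT (a n).
  by apply: measurableT_comp => //; exact: measurable_condexp.
have mrm (h : nat -> T -> R) N : (forall n, measurable_fun setT (h n)) ->
    measurable_fun setT (running_max h N).
  by move=> mh; elim: N => [|N IH] /=; [exact: mh | exact: measurable_maxr].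
have arm0 N x : 0 <= running_max a N x.
  by apply: running_max_ge0 => i y; exact: normr_ge0.
have frm0 N x : 0 <= running_max fn N x by exact: running_max_ge0.
apply: (@integral_le_of_approx _ _ _ P (fun N x => (running_max a N x `^ p * w x)%:E)) => //.
- by move=> N; apply: mfw; exact: mrm.
- apply: emeasurable_funM; last exact/measurable_EFinP.
  by apply: (measurableT_comp (measurable_poweR p)); exact: measurable_doob_max.
- by move=> x; rewrite mule_ge0 ?poweR_ge0 ?lee_fin.
- move=> x i j ij; rewrite lee_fin ler_wpM2r//.
  apply: ge0_ler_powR; rewrite ?nnegrE//; first exact: ltW.
  exact: running_max_nd.
- by move=> x; exact: doob_max_le_lim.
- move=> N.
  apply: le_trans (running_max_Ap_bound N c0 iabs (fun x => normr_ge0 _) Ap fnE fn0).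
  apply: ae_ge0_le_integral => //.
  + by apply: mfw; exact: mrm.
  + by apply: mfw; exact: mrm.
  + apply: filterS afn => x afx _; rewrite lee_fin ler_wpM2r//.
    apply: ge0_ler_powR; rewrite ?nnegrE//; first exact: ltW.
    by apply/running_max_le => i iN;
      exact: le_trans (afx i) (le_running_max _ _ iN).
Qed.

Lemma Ap_of_maximal_bound (K : R) n : 0 <= K ->
  (forall f : T -> R, measurable_fun setT f ->
    (\int[P]_x (`|f x| `^ p * w x)%:E < +oo)%E ->
    (\int[P]_x (doob_max P F f x `^ p * (w x)%:E) <=
     K%:E * \int[P]_x (`|f x| `^ p * w x)%:E)%E) ->
  {ae P, forall x, condexp P (F n) w x * condexp P (F n) s x `^ (p - 1) <= K}.
Proof.
move=> K0 bound.
have [wn [wnE wn0]] := is_condexp_gt0_version (sF n) (@FT n) iw w0.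
have [sn [snE sn0]] := is_condexp_gt0_version (sF n) (@FT n) isg s0.
have wn0W x : 0 <= wn x by exact: ltW.
have sn0W x : 0 <= sn x by exact: ltW.
have [mwn iwn _] := wnE.
have [msn isn snI] := snE.
have mwnT := measurable_wrt_measurable_fun (@FT n) mwn.
have msnT := measurable_wrt_measurable_fun (@FT n) msn.
pose A := [set x | K * sn x < sn x `^ p * wn x].
have FA : F n A.
  apply: (measurable_wrt_lt (sF n)); apply: (measurable_wrtM (sF n)) => //.
    exact: (measurable_wrt_cst (sF n)).
  exact: measurable_wrt_powR.
have mA := FT FA.
have mul_indic_powR (g : T -> R) x : (g x * \1_A x) `^ p = g x `^ p * \1_A x.
  by rewrite indicE; case: (_ \in _); rewrite ?mulr1// !mulr0 powR0// gt_eqF.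
pose f x := s x * \1_A x.
have mf : measurable_fun setT f by apply: measurable_funM => //;
  exact: measurable_indic.
have f0 x : 0 <= f x by rewrite mulr_ge0.
have normf : (\int[P]_x (`|f x| `^ p * w x)%:E = \int[P]_(x in A) (s x)%:E)%E.
  rewrite -[A in RHS]setTI -integral_mul_indic; apply: eq_integral => x _.
  by rewrite ger0_norm// /f mul_indic_powR mulrAC (dual_powR_mul p1 (w0 x)).
have intsA : (\int[P]_(x in A) (s x)%:E \is a fin_num)%E.
  apply: integrable_fin_num => //.
  exact: (integrableS measurableT mA (@subsetT _ A) isg).
have foo : (\int[P]_x (`|f x| `^ p * w x)%:E < +oo)%E.
  by rewrite normf ltey_eq intsA.
have if_ := wLp_integrable mf foo.
have cfE : {ae P, forall x, condexp P (F n) f x = sn x * \1_A x}.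
  apply: (is_condexp_ae_eq (sF n) (@FT n) if_).
    exact: (is_condexp_condexp (sF n) (@FT n)).
  exact: (is_condexp_indic (sF n) (@FT n)).
(* The pull-out property turns [wn] into [w]. On [A] the maximal function of [f] is almost
   everywhere at least [sn], so the assumed bound leads to [K] times the integral of [s], hence of
   [sn], over [A]. *)
have main : (\int[P]_(x in A) (sn x `^ p * wn x)%:E <= \int[P]_(x in A) (K * sn x)%:E)%E.
  have -> : (\int[P]_(x in A) (K * sn x)%:E = K%:E * \int[P]_(x in A) (s x)%:E)%E.
    rewrite -snI// -ge0_integralZl//.
      by apply/measurable_EFinP; exact: measurable_funTS.
    by move=> x _; rewrite lee_fin.
  rewrite -(integral_condexp_mul_in (sF n) (@FT n) wnE)//; last 2 first.
  - exact: measurable_wrt_powR.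
  - by move=> x; exact: powR_ge0.
  rewrite -normf; apply: le_trans (bound f mf foo).
  rewrite -[A in leLHS]setTI -integral_mul_indic.
  apply: ae_ge0_le_integral => //.
  - by move=> x _; rewrite lee_fin mulr_ge0// mulr_ge0 ?powR_ge0.
  - apply/measurable_EFinP; apply: measurable_funM;
      last exact: measurable_indic.
    by apply: measurable_funM => //; exact: measurable_fun_powRr.
  - by move=> x _; rewrite mule_ge0 ?poweR_ge0 ?lee_fin.
  - apply: emeasurable_funM; last exact/measurable_EFinP.
    by apply: (measurableT_comp (measurable_poweR p));
      exact: measurable_doob_max.
  apply: filterS cfE => x cfx _.
  rewrite mulrAC -mul_indic_powR EFinM -poweR_EFin.
  apply: lee_wpmul2r; first by rewrite lee_fin.
  apply: gt0_ler_poweR; first exact: ltW.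
  - by rewrite in_itv/= lee_fin mulr_ge0// leey.
  - by rewrite in_itv/= doob_max_ge0 leey.
  apply: ereal_sup_ubound; exists n => //.
  by rewrite cfx ger0_norm// mulr_ge0.
have iKsn : P.-integrable A (EFin \o (fun x => K * sn x)).
  have : P.-integrable A (fun x => K%:E * (sn x)%:E)%E.
    apply: integrableZl => //.
    exact: (integrableS measurableT mA (@subsetT _ A) isn).
  by apply: eq_integrable => // x _; rewrite EFinM.
have mswn : measurable_fun A (fun x => sn x `^ p * wn x).
  apply: measurable_funTS; apply: measurable_funM => //;
    exact: measurable_fun_powRr.
have PA : P A = 0%E.
  apply: (@null_of_integral_le _ _ _ P A (fun x => K * sn x)
    (fun x => sn x `^ p * wn x)) => //.
  (* Integrability of [sn^p * wn] on [A] itself comes from [main]. *)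
  apply/integrableP; split; first exact/measurable_EFinP.
  apply: (@le_lt_trans _ _ (\int[P]_(x in A) (sn x `^ p * wn x)%:E)%E).
    rewrite le_eqVlt; apply/orP; left; apply/eqP; apply: eq_integral => x _.
    by rewrite /= ger0_norm// mulr_ge0 ?powR_ge0.
  apply: (le_lt_trans main).
  by rewrite ltey_eq integrable_fin_num.
have Aae : {ae P, forall x, ~ A x}.
  by exists A; split => // x /=; rewrite notK.
have h1 := is_condexp_ae_eq (sF n) (@FT n) iw
    (is_condexp_condexp (sF n) (@FT n) iw) wnE.
have h2 := is_condexp_ae_eq (sF n) (@FT n) isg
    (is_condexp_condexp (sF n) (@FT n) isg) snE.
apply: filterS3 h1 h2 Aae => x -> -> /negP; rewrite -leNgt.
by rewrite -(powRB1_mul p1 (sn0W x)) mulrAC ler_pM2r// mulrC.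
Qed.

End positive_weight.

(** The [p]-th root of the product of the two Doob factors. With [q = p / (p - 1)] one has
    [q / (q - 1) = p], so it equals [((2p)^q (2q)^p)^(1/p)]. *)
Definition doob_Ap_constant (R : realType) (p : R) : R :=
  ((2 * (p / (p - 1) / (p / (p - 1) - 1))) `^ (p / (p - 1)) *
   (2 * (p / (p - 1))) `^ p) `^ p^-1.

Lemma poweRV_le_mul (R : realType) (p C : R) (a b : \bar R) :
  0 < p -> 0 <= C -> (0 <= a)%E -> (0 <= b)%E ->
  (a `^ p^-1 <= C%:E * b `^ p^-1)%E <-> (a <= (C `^ p)%:E * b)%E.
Proof.
move=> p0 C0 a0 b0.
have itv (x : \bar R) : (0 <= x)%E -> x \in `[0%E, +oo%E].
  by move=> x0; rewrite in_itv/= x0 leey.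
have pK (x : \bar R) : (0 <= x)%E -> ((x `^ p^-1) `^ p = x)%E.
  by move=> x0; rewrite -poweRrM mulVf ?gt_eqF// poweRe1.
have Cb0 : (0 <= C%:E * b `^ p^-1)%E by rewrite mule_ge0 ?lee_fin ?poweR_ge0.
have E : ((C%:E * b `^ p^-1) `^ p = (C `^ p)%:E * b)%E.
  by rewrite poweRM ?lee_fin ?poweR_ge0// pK// poweR_EFin.
split=> ab.
  rewrite -(pK _ a0) -E; apply: gt0_ler_poweR; rewrite ?itv ?poweR_ge0//.
  exact: ltW.
have -> : (C%:E * b `^ p^-1 = ((C `^ p)%:E * b) `^ p^-1)%E.
  by rewrite -E -poweRrM mulfV ?gt_eqF// poweRe1.
apply: gt0_ler_poweR; rewrite ?itv ?invr_ge0 ?mule_ge0 ?lee_fin ?powR_ge0//.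
exact: ltW.
Qed.

(** * Norm inequalities, the [A_p] constant and the smallest admissible constant *)

Section positive_weight_norms.
Context (R : realType) (d : measure_display) (T : measurableType d)
  (P : probability T R) (F : nat -> set (set T)) (p : R) (w : T -> R).
Hypothesis fsF : filtered_space P F.
Let sF := fs_sigma fsF.
Let FT := fs_sub fsF.
Hypothesis p1 : 1 < p.
Hypothesis w0 : forall x, 0 < w x.
Hypothesis iw : P.-integrable setT (EFin \o w).
Hypothesis isg : P.-integrable setT (EFin \o dual_weight p w).

Let p0 : 0 < p. Proof. exact: lt_trans p1. Qed.
Let w0W x : 0 <= w x. Proof. exact: ltW. Qed.

Lemma wLnormE (f : T -> R) :
  wLnorm P p w (EFin \o f) = ((\int[P]_x (`|f x| `^ p * w x)%:E) `^ p^-1)%E.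
Proof. by []. Qed.

Lemma wLnorm_doob_max (f : T -> R) : wLnorm P p w (doob_max P F f) =
  ((\int[P]_x (doob_max P F f x `^ p * (w x)%:E)) `^ p^-1)%E.
Proof.
by congr poweR; apply: eq_integral => x _; rewrite gee0_abs ?doob_max_ge0.
Qed.

Lemma wLnorm_le (f : T -> R) (C : R) : 0 <= C ->
  (wLnorm P p w (doob_max P F f) <= C%:E * wLnorm P p w (EFin \o f))%E <->
  (\int[P]_x (doob_max P F f x `^ p * (w x)%:E) <=
   (C `^ p)%:E * \int[P]_x (`|f x| `^ p * w x)%:E)%E.
Proof.
move=> C0; rewrite wLnorm_doob_max wLnormE; apply: poweRV_le_mul => //.
  by apply: integral_ge0 => x _; rewrite mule_ge0 ?poweR_ge0 ?lee_fin.
by apply: integral_ge0 => x _; rewrite lee_fin mulr_ge0 ?powR_ge0.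
Qed.

Lemma in_wLpP (f : T -> R) : in_wLp P p w f <->
  measurable_fun setT f /\ (\int[P]_x (`|f x| `^ p * w x)%:E < +oo)%E.
Proof.
rewrite /in_wLp wLnormE; split=> -[mf h]; split=> //; last exact: poweR_lty.
by apply: lty_poweRy h; rewrite invr_eq0 gt_eqF.
Qed.

(** The constant function 1 has positive finite norm, because [w] is positive and integrable. The
    sign is needed before raising bounds to the power [p]. *)
Lemma doob_bound_ge0 (C : R) : doob_bound P F p w C -> 0 <= C.
Proof.
move=> /(_ (fun=> 1)) bound.
have E : (\int[P]_x (`|1| `^ p * w x)%:E = \int[P]_x (w x)%:E)%E.
  by apply: eq_integral => x _; rewrite normr1 powR1 mul1r.
have fin : (\int[P]_x (w x)%:E \is a fin_num)%E by exact: integrable_fin_num.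
have : in_wLp P p w (fun=> 1).
  by apply/in_wLpP; split=> //; rewrite E ltey_eq fin.
move=> /bound; rewrite wLnorm_doob_max wLnormE E.
set I := (\int[P]_x (w x)%:E)%E in fin *.
have I0 : (0 < I)%E.
  rewrite lt0e integral_ge0 ?andbT; last by move=> x _; rewrite lee_fin.
  apply/eqP => I0.
  have : P setT = 0%E.
    apply: (@null_of_integral_le _ _ _ P setT (fun=> 0) w) => //.
      exact: integrable0.
    by rewrite integral0 -/I I0.
  by rewrite probability_setT => /eqP; rewrite eqe oner_eq0.
have := fineK fin; move: I0; case: I fin => [i||]// _ i0 _.
rewrite poweR_EFin -EFinM => /(le_trans (poweR_ge0 _ _)).
by rewrite lee_fin pmulr_lge0// powR_gt0.
Qed.

(** The essential supremum is that of an absolute value, which is harmless: [condexp P (F n) w]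
    agrees almost everywhere with a positive version. *)
Lemma ess_Ap_leP (K : R) n :
  (Lnorm P +oo%E (fun x => (condexp P (F n) w x
     * condexp P (F n) (dual_weight p w) x `^ (p - 1))%:E) <= K%:E)%E <->
  {ae P, forall x, condexp P (F n) w x
     * condexp P (F n) (dual_weight p w) x `^ (p - 1) <= K}.
Proof.
have PT : (0 < P [set: T])%E by rewrite probability_setT lte01.
rewrite unlock PT; split.
  move=> /ess_supP; apply: filterS => x /=; rewrite lee_fin.
  exact: le_trans (ler_norm _).
move=> le; apply/ess_supP.
have [wn [wnE wn0]] := is_condexp_gt0_version (sF n) (@FT n) iw w0.
have h := is_condexp_ae_eq (sF n) (@FT n) iw
    (is_condexp_condexp (sF n) (@FT n) iw) wnE.
move: h le; apply: filterS2 => x cx le /=.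
by rewrite lee_fin ger0_norm// cx mulr_ge0 ?powR_ge0// ltW.
Qed.

Lemma Ap_const_leP (K : R) : (Ap_const P F p w <= K%:E)%E <->
  (forall n, {ae P, forall x, condexp P (F n) w x
     * condexp P (F n) (dual_weight p w) x `^ (p - 1) <= K}).
Proof.
split=> [le n|le].
  by apply/ess_Ap_leP; apply: le_trans le; apply: ereal_sup_ubound; exists n.
by apply: ge_ereal_sup => _ [n _ <-]; exact/ess_Ap_leP.
Qed.

Lemma Ap_const_ge0 : (0 <= Ap_const P F p w)%E.
Proof.
apply: (@le_trans _ _ (Lnorm P +oo%E (fun x => (condexp P (F 0) w x
     * condexp P (F 0) (dual_weight p w) x `^ (p - 1))%:E))).
  exact: Lnorm_ge0.
by apply: ereal_sup_ubound; exists 0%N.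
Qed.

Lemma Ap_const_le_doob_bound (C : R) : doob_bound P F p w C ->
  (Ap_const P F p w <= (C `^ p)%:E)%E.
Proof.
move=> bound; have C0 := doob_bound_ge0 bound.
apply/Ap_const_leP => n.
apply: (Ap_of_maximal_bound fsF) => //; first exact: powR_ge0.
by move=> f mf foo; apply/wLnorm_le => //; apply/bound/in_wLpP.
Qed.

Lemma doob_bound_Ap_const (c : R) : (Ap_const P F p w = c%:E)%E ->
  doob_bound P F p w (doob_Ap_constant p * c `^ (p - 1)^-1).
Proof.
move=> Apc; have c0 : 0 <= c by rewrite -lee_fin -Apc Ap_const_ge0.
have pB1 : p - 1 != 0 by rewrite subr_eq0 gt_eqF.
move=> f /in_wLpP[mf foo].
apply/wLnorm_le; first by rewrite mulr_ge0 ?powR_ge0.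
apply: le_trans (doob_max_Ap_bound fsF p1 w0 iw isg c0 mf foo _) _.
  by apply/Ap_const_leP; rewrite Apc.
have Cp0 : 0 <= doob_Ap_constant p by exact: powR_ge0.
(* In the [p]-th power of the claimed constant the outer root disappears and [c^(1/(p-1))] becomes
   [c^(p/(p-1))]. *)
rewrite !muleA -!EFinM (powRM _ Cp0 (powR_ge0 _ _)) /doob_Ap_constant -!powRrM.
rewrite mulVf ?gt_eqF// powRr1 ?mulr_ge0 ?powR_ge0//.
by rewrite [_^-1 * p]mulrC mulrAC.
Qed.

(** The infimum of the admissible constants is itself admissible: for each fixed [f] the norm on the
    right is finite, so the inequality passes to the limit. *)
Lemma doob_norm_ex : (exists C, doob_bound P F p w C) ->
  exists N, is_doob_norm P F p w N.
Proof.
move=> [C0 bound0].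
pose S := [set C | doob_bound P F p w C].
have lbS : lbound S 0 by move=> C; exact: doob_bound_ge0.
have infS : has_inf S by split; [exists C0|exists 0].
exists (inf S); split; last by move=> C bC; apply: ge_inf => //; exists 0.
have inf0 : 0 <= inf S by apply: lb_le_inf => //; exists C0.
move=> f fL.
have foo := fL.2.
have n0 : (0 <= wLnorm P p w (EFin \o f))%E by exact: poweR_ge0.
have : wLnorm P p w (EFin \o f) \is a fin_num by rewrite ge0_fin_numE.
move: (bound0 f fL) => b0.
move=> /fineK fK; rewrite -fK; set b := fine _ in fK *.
have b_ge0 : 0 <= b by rewrite -lee_fin fK.
apply/lee_addgt0Pr => e e0.
(* The norm [b] may be 0, hence the division of [e] by [b + 1]. *)
have b10 : 0 < b + 1 by rewrite ltr_wpDl.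
have [C CS Ce] := inf_adherent (divr_gt0 e0 b10) infS.
apply: le_trans (CS f fL) _; rewrite -fK -/b -EFinM -EFinD lee_fin.
apply: (@le_trans _ _ ((inf S + e / (b + 1)) * b));
  first by rewrite ler_wpM2r// ltW.
rewrite mulrDl lerD2l mulrAC ler_pdivrMr// ler_wpM2l ?ltW//.
by rewrite ltrDl.
Qed.

End positive_weight_norms.

(** * Invariance under changes of the weight on a null set, and the conclusion *)

Section null_set_modification.
Context (R : realType) (d : measure_display) (T : measurableType d)
  (P : probability T R).

(** The equality is pointwise: both functions have the same set of versions, and the choice made by
    [xget] depends only on that set. *)
Lemma ae_eq_condexp (G : set (set T)) (f f' : T -> R) : G `<=` measurable ->
  measurable_fun setT f -> measurable_fun setT f' ->
  {ae P, forall x, f x = f' x} -> condexp P G f = condexp P G f'.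
Proof.
move=> GT mf mf' ff'.
have E A : G A -> (\int[P]_(x in A) (f x)%:E = \int[P]_(x in A) (f' x)%:E)%E.
  move=> GA; apply: ae_eq_integral => //.
  - exact: GT.
  - exact/measurable_EFinP/measurable_funTS.
  - exact/measurable_EFinP/measurable_funTS.
  - by apply: filterS ff' => x -> _.
rewrite /condexp; congr (xget _ _); apply/seteqP; split=> g [mg ig gE];
  split=> // A GA.
  by rewrite gE// E.
by rewrite gE// -E.
Qed.

Lemma ae_eq_wLnorm (p : R) (w w' : T -> R) (f : T -> \bar R) :
  measurable_fun setT f -> measurable_fun setT w -> measurable_fun setT w' ->
  {ae P, forall x, w x = w' x} -> wLnorm P p w f = wLnorm P p w' f.
Proof.
move=> mf mw mw' ww'; rewrite /wLnorm; congr poweR.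
have mfw (v : T -> R) : measurable_fun setT v ->
    measurable_fun setT (fun x => `|f x| `^ p * (v x)%:E)%E.
  move=> mv; apply: emeasurable_funM; last exact/measurable_EFinP.
  apply: (measurableT_comp (measurable_poweR p)).
  exact: measurableT_comp.
apply: ae_eq_integral => //; [exact: mfw..|].
by apply: filterS ww' => x -> _.
Qed.

(** Stated as an equality of predicates so that it rewrites both the boundedness condition and the
    minimality in [is_doob_norm]. *)
Lemma ae_eq_doob_bound (F : nat -> set (set T)) (p : R) (w w' : T -> R) :
  filtered_space P F ->
  measurable_fun setT w -> measurable_fun setT w' ->
  {ae P, forall x, w x = w' x} -> doob_bound P F p w = doob_bound P F p w'.
Proof.
move=> fsF mw mw' ww'; apply/funext => C; apply/propext.
have E f : measurable_fun setT f -> wLnorm P p w f = wLnorm P p w' f.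
  by move=> mf; exact: ae_eq_wLnorm.
by split=> bound f [mf foo]; have mEf : measurable_fun setT (EFin \o f);
  do ?[exact/measurable_EFinP];
  have := bound f; rewrite /in_wLp !E//; do ?[exact: measurable_doob_max];
  apply; split=> //; rewrite ?E// -?E.
Qed.

Lemma ae_eq_Ap_const (F : nat -> set (set T)) (p : R) (w w' : T -> R) :
  filtered_space P F ->
  measurable_fun setT w -> measurable_fun setT w' ->
  {ae P, forall x, w x = w' x} -> Ap_const P F p w = Ap_const P F p w'.
Proof.
move=> fsF mw mw' ww'.
have cw n : condexp P (F n) w = condexp P (F n) w'.
  exact: ae_eq_condexp (@fs_sub _ _ _ _ _ fsF n) mw mw' ww'.
have cs n : condexp P (F n) (dual_weight p w) = condexp P (F n) (dual_weight p w').
  apply: (ae_eq_condexp (@fs_sub _ _ _ _ _ fsF n)).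
  - exact: (measurableT_comp (measurable_powR _)).
  - exact: (measurableT_comp (measurable_powR _)).
  - by apply: filterS ww' => x; rewrite /dual_weight => ->.
apply/eqP; rewrite eq_le; apply/andP; split.
  apply: ge_ereal_sup => _ [n _ <-].
  by rewrite cs cw; apply: ereal_sup_ubound; exists n.
apply: ge_ereal_sup => _ [n _ <-]; rewrite -cs -cw.
by apply: ereal_sup_ubound; exists n.
Qed.

End null_set_modification.

Theorem theorem1p11 (R : realType) (p : R) (hp : 1 < p) :
  exists Cp : R,
    forall (d : measure_display) (T : measurableType d) (P : probability T R)
           (F : nat -> set (set T)) (w : T -> R),
      filtered_space P F ->
      is_weight P w ->
      P.-integrable setT (EFin \o dual_weight p w) ->
      ((exists C : R, doob_bound P F p w C) <-> (Ap_const P F p w < +oo)%E) /\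
      ((exists C : R, doob_bound P F p w C) ->
       exists N : R,
         [/\ is_doob_norm P F p w N,
             (Ap_const P F p w <= (N `^ p)%:E)%E &
             (N%:E <= Cp%:E * Ap_const P F p w `^ (p - 1)^-1)%E]).
Proof.
exists (doob_Ap_constant p) => d T P F w fsF [iw wpos] isg.
(* A weight is positive only almost everywhere; the value 1 on the exceptional null set gives the
   everywhere positive weight required above. *)
pose w' x := if 0 < w x then w x else 1.
have w'0 x : 0 < w' x by rewrite /w'; case: ifPn.
have mw : measurable_fun setT w by apply/measurable_EFinP;
  exact: measurable_int iw.
have mw' : measurable_fun setT w'.
  apply: measurable_fun_ifT => //.
  exact: measurable_fun_ltr.
have ww' : {ae P, forall x, w x = w' x}.
  by apply: filterS wpos => x wx0; rewrite /w' wx0.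
have ae_int (f g : T -> R) : measurable_fun setT f -> measurable_fun setT g ->
    {ae P, forall x, f x = g x} ->
    P.-integrable setT (EFin \o f) -> P.-integrable setT (EFin \o g).
  move=> mf mg fg if_; apply/integrableP; split; first exact/measurable_EFinP.
  have /integrableP[_] := if_; congr (_ < _)%E; apply: ae_eq_integral => //.
  - by apply: measurableT_comp => //; exact/measurable_EFinP.
  - by apply: measurableT_comp => //; exact/measurable_EFinP.
  - by apply: filterS fg => x /= -> _.
have ss' : {ae P, forall x, dual_weight p w x = dual_weight p w' x}.
  by apply: filterS ww' => x; rewrite /dual_weight => ->.
have iw' : P.-integrable setT (EFin \o w') by exact: ae_int iw.
have isg' : P.-integrable setT (EFin \o dual_weight p w').
  by apply: ae_int isg => //; exact: measurable_fun_powRr.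
rewrite /is_doob_norm (ae_eq_doob_bound p fsF mw mw' ww').
rewrite (ae_eq_Ap_const p fsF mw mw' ww').
have Apfin : (exists C : R, doob_bound P F p w' C) -> (Ap_const P F p w' < +oo)%E.
  move=> [C bound].
  have /le_lt_trans := Ap_const_le_doob_bound fsF hp w'0 iw' isg' bound.
  by apply; exact: ltey.
have Ap0 := Ap_const_ge0 P F p w'.
have Apc : (Ap_const P F p w' < +oo)%E ->
    exists2 c, Ap_const P F p w' = c%:E &
      doob_bound P F p w' (doob_Ap_constant p * c `^ (p - 1)^-1).
  rewrite -ge0_fin_numE// => /fineK/esym Apc.
  by exists (fine (Ap_const P F p w')) => //; exact: doob_bound_Ap_const.
split.
  by split=> [//|/Apc[c _ bound]]; eexists; exact: bound.
move=> ex.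
have [N [boundN Nmin]] := doob_norm_ex hp w'0 iw' ex.
exists N; split=> //; first exact: (Ap_const_le_doob_bound fsF).
(* The smallest constant is compared with the explicit admissible one. *)
have [c -> bound] := Apc (Apfin ex).
by rewrite poweR_EFin -EFinM lee_fin; exact: Nmin.
Qed.
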